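(* Let $q\geq 5$ be a prime power and let $Z$ and $\mathcal{L}_5$ be the surface over $\mathbf{F}_q$ and the line bundle described in the context. The code $C_L(Z,\mathcal{L}_5)$ has parameters $$[q^2+q+1,\ 18,\ q^2-3q-1],$$ i.e. length $q^2+q+1$, dimension $18$ and minimum distance $q^2-3q-1$.
   Context: Let $P$ be a closed point of degree $3$ of $\mathbf{P}^2$ over $\mathbf{F}_q$ which is not contained in any line defined over $\mathbf{F}_q$ (so over $\mathbf{F}_{q^3}$ it splits into three non collinear Frobenius-conjugate points). Let $\pi:Z\to\mathbf{P}^2$ be the blow up of $\mathbf{P}^2$ at $P$, with exceptional divisor $E$. Let $\Gamma_5$ be the linear system of plane curves of degree $5$ containing $P$, and let $\mathcal{L}_5$ be the line bundle on $Z$ associated to $\pi^{\star}\Gamma_5-E$ (so $\mathcal{L}_5\cong\mathcal{O}_Z(5\pi^{\star}L-E)$ with $L$ a line of $\mathbf{P}^2$). For a line bundle $\mathcal{L}$ on a smooth projective geometrically irreducible surface $X$ over $\mathbf{F}_q$ with rational points $X(\mathbf{F}_q)=\{P_1,\dots,P_n\}$ (all of them), the code $C_L(X,\mathcal{L})\subset \mathbf{F}_q^n$ is the image of the evaluation map $H^0(X,\mathcal{L})\to\bigoplus_i \mathcal{L}_{P_i}\simeq\mathbf{F}_q^n$, $f\mapsto (f_{P_1},\dots,f_{P_n})$, where a coordinate has been chosen on each fibre (different choices give codes isometric for the Hamming distance). A code with parameters $[n,k,d]$ has length $n$, dimension $k$ and minimum Hamming distance $d$. *)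

(* Defs.v *)
From HB Require Import structures.
From mathcomp Require Import all_boot all_order all_algebra all_field.
From mathcomp Require Import fraction mpoly.

Set Implicit Arguments.
Unset Strict Implicit.
Unset Printing Implicit Defensive.

Import GRing.Theory.
Local Open Scope ring_scope.

(* MathComp has no schemes.  An integral separated F-scheme X is presented here
   by an affine open cover: a family of subrings R_c of one field K, all with
   the same fraction field, such that X is the union of the Spec R_c (points of
   two charts being identified when their local rings in K are equal).  A line
   bundle on X is presented as the subsheaf of the constant sheaf K with
   sections e_c R_c over Spec R_c, where e_c in K^* is a local generator. *)

Section AtlasCode.

Variables F K : fieldType.

Record atlas := Atlas {
  chart : Type;
  chart_ring : chart -> K -> Prop;
  scalar : F -> K }.

Variable X : atlas.

(* phi : R_c -> F is a homomorphism of F-algebras; its values outside R_c are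
   irrelevant. *)
Definition is_eval (c : chart X) (phi : K -> F) : Prop :=
  [/\ forall a, phi (scalar X a) = a,
      forall f g, chart_ring c f -> chart_ring c g -> phi (f + g) = phi f + phi g
    & forall f g, chart_ring c f -> chart_ring c g -> phi (f * g) = phi f * phi g].

Record rational_point := RationalPoint {
  pt_chart : chart X;
  pt_eval : K -> F;
  pt_evalP : is_eval pt_chart pt_eval }.

Definition local_ring (P : rational_point) (f : K) : Prop :=
  exists a b, [/\ chart_ring (pt_chart P) a, chart_ring (pt_chart P) b,
                  pt_eval P b != 0 & f = a / b].

(* On an integral separated scheme a point is determined by its local ring in
   the function field (and an F-algebra has at most one local homomorphism
   to F with given kernel, so the evaluation maps agree as well). *)
Definition same_point (P Q : rational_point) : Prop :=
  forall f, local_ring P f <-> local_ring Q f.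

(* P_0, ..., P_(n-1) lists all the points of X(F), each of them once. *)
Definition enumerates_points (n : nat) (P : 'I_n -> rational_point) : Prop :=
  (forall Q, exists i, same_point Q (P i)) /\
  (forall i j, same_point (P i) (P j) -> i = j).

Section LineBundle.

Variable e : chart X -> K.

Definition global_section (s : K) : Prop :=
  forall c, chart_ring c (s / e c).

(* The fibre at P has the basis e_c(P), c being the chart carrying P, and every
   coordinate on this fibre is a nonzero multiple u of the dual basis. *)
Definition fibre_coord (P : rational_point) (u : F) (s : K) : F :=
  u * pt_eval P (s / e (pt_chart P)).

Definition C_L (n : nat) (P : 'I_n -> rational_point) (u : 'I_n -> F)
    (w : 'rV[F]_n) : Prop :=
  exists2 s, global_section s & w = \row_i fibre_coord (P i) (u i) s.

End LineBundle.

End AtlasCode.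

Section Codes.

Variables (F : fieldType) (n : nat).

Definition hamming_dist (v w : 'rV[F]_n) : nat := #|[set i | v 0 i != w 0 i]|.

Definition has_dimension (C : 'rV[F]_n -> Prop) (k : nat) : Prop :=
  exists V : {vspace 'rV[F]_n}, (forall w, w \in V <-> C w) /\ \dim V = k.

Definition has_min_distance (C : 'rV[F]_n -> Prop) (d : nat) : Prop :=
  (exists v w, [/\ C v, C w, v != w & hamming_dist v w = d]) /\
  (forall v w, C v -> C w -> v != w -> (d <= hamming_dist v w)%N).

Definition has_parameters (C : 'rV[F]_n -> Prop) (N k d : nat) : Prop :=
  [/\ n = N, has_dimension C k & has_min_distance C d].

End Codes.

Section BlowUp.

Variables (F : fieldType) (L : fieldExtType F).

(* A closed point of the projective plane over F is given by homogeneous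
   coordinates p in an extension L of F (one geometric point of its Galois
   orbit).  Its residue field is generated by the ratios p_i / p_j. *)
Variable p : 'I_3 -> L.

Definition closed_point_degree : nat :=
  \dim <<1 & [seq p i / p j | i <- enum 'I_3, j <- enum 'I_3]>>%VS.

Definition on_rational_line : Prop :=
  exists a : 'I_3 -> F,
    (exists i, a i != 0) /\ \sum_(i < 3) a i *: p i = 0.

Definition homog_frac : fieldType := {fraction {mpoly F[3]}}.

Definition xcoord (j : 'I_3) : homog_frac := tofrac ('X_j).

Definition vanishes_at (G : {mpoly F[3]}) : Prop :=
  (map_mpoly (in_alg L) G).@[p] = 0.

(* The coordinate ring F[x_i / x_j] of the standard open set x_j <> 0. *)
Definition plane_ring (j : 'I_3) (f : homog_frac) : Prop :=
  exists d (G : {mpoly F[3]}), G \is d.-homog /\ f = tofrac G / xcoord j ^+ d.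

(* The ideal of the closed point p in plane_ring j. *)
Definition point_ideal (j : 'I_3) (f : homog_frac) : Prop :=
  exists d (G : {mpoly F[3]}),
    [/\ G \is d.-homog, vanishes_at G & f = tofrac G / xcoord j ^+ d].

(* With A = plane_ring j and I = point_ideal j, the blow up of Spec A along I is
   Proj of the Rees algebra of I, covered by the spectra of the affine blowup
   algebras A[I/g] for g a nonzero element of I. *)
Record blowup_chart := BlowupChart {
  bc_idx : 'I_3;
  bc_gen : homog_frac;
  bc_gen_ideal : point_ideal bc_idx bc_gen;
  bc_gen_neq0 : bc_gen != 0 }.

Inductive blowup_ring (c : blowup_chart) : homog_frac -> Prop :=
| BlowupBase f of plane_ring (bc_idx c) f : blowup_ring c f
| BlowupFrac h of point_ideal (bc_idx c) h : blowup_ring c (h / bc_gen c)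
| BlowupAdd f g of blowup_ring c f & blowup_ring c g : blowup_ring c (f + g)
| BlowupMul f g of blowup_ring c f & blowup_ring c g : blowup_ring c (f * g).

Definition Z : atlas F homog_frac :=
  Atlas blowup_ring (fun a => tofrac (a%:MP)).

(* O_Z(m pi^*L - r E): on the chart c, the pullback of O(m) is generated by
   x_j^m, and O(-E), the inverse image ideal sheaf of I, by g. *)
Definition O_Z (m r : nat) (c : chart Z) : homog_frac :=
  xcoord (bc_idx c) ^+ m * bc_gen c ^+ r.

Definition L5 : chart Z -> homog_frac := O_Z 5 1.

End BlowUp.

(* Main.v *)
Require Import Defs.
From mathcomp Require Import all_boot all_order all_algebra all_field.
From HB Require Import structures.
From mathcomp Require Import mxabelem fraction mpoly zify ring.
From Stdlib Require Import Classical ClassicalEpsilon.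

(** Three facts together give the theorem.

    The evaluation code is a code of plane quintics.  A rational point of the
    blow-up lies over a rational point of the plane, and the closed point p is
    not rational; some conic through p misses the given rational point, so the
    blow-up is an isomorphism near it.  Hence the rational points of Z are
    those of the plane ([plane_pt_surj], [same_plane_pt]).  A section of L5 is
    a fraction whose denominator may be read in any chart.  In one chart it is
    monic in the third coordinate, in another it does not involve that
    coordinate, so the fraction is a polynomial ([section_poly]); the order of
    vanishing along a line through p forces this quintic form to vanish at p
    ([section_vanishes]).

    The dimension is 21 - 3.  The values at p of the quintic forms make up a
    space of dimension 3 over F, namely the residue field of p rescaled
    ([dim_values_at]), and the bound on zeros below shows that no nonzero form
    vanishes at all the rational points.

    A nonzero quintic form vanishing at p has at most 4q + 2 rational zeros
    ([quintic_bound]).  A rational line never passes through p, so a line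
    contained in the quintic can be split off, at most three times: a linear
    form vanishing at p is zero.  What remains is a curve of some degree d
    without rational lines, and N rational points.  For a line a write n(a) for
    the number of its points on the curve, t(a) for the number of those at
    which it is tangent.  Then n(a) + t(a) <= d, and every point of the curve
    has a tangent, so the sum of the t(a) is at least N.  Double counting gives
    the sum of n(a) (d - n(a)) as N ((d - 1)(q + 1) + 1 - N), while each term
    is at least ceil(d / 2) t(a); so N is at most
    (d - 1)(q + 1) + 1 - ceil(d / 2), that is 4q + 2, 3q + 2, 2q + 1, q + 1 for
    d = 5, 4, 3, 2 ([lineless_bound]).  With the lines put back this is 4q + 2,
    unless the quintic is a line together with a quartic with 3q + 2 points, all
    of them off the line.  That quartic would meet every line in 0, 2 or 4
    points, and every line meeting it twice would be a bitangent.  Then q is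
    even, and a study of the bitangents in characteristic 2 shows that all
    tangents are concurrent, which leaves room for too few points
    ([no_maximal_quartic_off_line]).

    Finally 4q + 2 is attained ([extremal_quintic]) by a conic through p
    together with three concurrent rational lines which miss its q + 1 points;
    counting incidences shows that three such lines exist as soon as
    q >= 5. *)

Set Implicit Arguments.
Unset Strict Implicit.
Unset Printing Implicit Defensive.

Import GRing.Theory.
Local Open Scope ring_scope.


(** * Points and lines of the projective plane over F *)

Section Plane.
Variable F : finFieldType.
Notation V := 'rV[F]_3.
Notation q := #|F|.

Definition first_coord (v : V) : F :=
  if [pick i | v 0 i != 0] is Some i then v 0 i else 0.

(** A point of the plane is represented by its coordinate vector whose first
    nonzero entry is 1.  By duality the same set also represents the lines,
    a line being given by the coefficients of its equation. *)
Definition pts : {set V} := [set v | first_coord v == 1].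

Definition normalize (v : V) : V := (first_coord v)^-1 *: v.

Definition inc (a v : V) : bool := v *m a^T == 0.

Lemma first_coordZ c v : c != 0 -> first_coord (c *: v) = c * first_coord v.
Proof.
move=> c0; rewrite /first_coord (eq_pick (Q := fun i => v 0 i != 0)); last first.
  by move=> i; rewrite /= mxE mulf_eq0 (negPf c0).
by case: pickP => [i _|_]; rewrite ?mxE ?mulr0.
Qed.

Lemma first_coord_eq0 v : (first_coord v == 0) = (v == 0).
Proof.
rewrite /first_coord; case: pickP => [i vi|v0].
  by rewrite (negPf vi); apply/esym/negbTE; apply: contraNneq vi => ->; rewrite mxE.
by rewrite eqxx; apply/esym/eqP/rowP => i; rewrite mxE; apply/eqP/negbFE/v0.
Qed.

Lemma pts_neq0 v : v \in pts -> v != 0.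
Proof. by rewrite inE -first_coord_eq0 => /eqP ->; rewrite oner_eq0. Qed.

Lemma normalize_pts v : v != 0 -> normalize v \in pts.
Proof.
by move=> v0; rewrite inE first_coordZ ?invr_eq0 ?first_coord_eq0 // mulVf // first_coord_eq0.
Qed.

Lemma pts_scale u v c : u \in pts -> v \in pts -> u = c *: v -> u = v.
Proof.
move=> up vp uE; have c0: c != 0.
  by apply: contraNneq (pts_neq0 up) => c0; rewrite uE c0 scale0r.
move: up vp; rewrite !inE => /eqP u1 /eqP v1; move: u1; rewrite uE first_coordZ // v1.
by rewrite mulr1 => ->; rewrite scale1r.
Qed.

Lemma normalize_id v : v \in pts -> normalize v = v.
Proof. by rewrite inE /normalize => /eqP ->; rewrite invr1 scale1r. Qed.

Lemma incC a v : inc a v = inc v a.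
Proof.
rewrite /inc -[v *m a^T]trmxK trmx_mul trmxK.
by rewrite -[X in _ == X]trmx0 (inj_eq (can_inj (@trmxK _ _ _))).
Qed.

Lemma incD a v w : inc a v -> inc a w -> inc a (v + w).
Proof. by rewrite /inc mulmxDl => /eqP -> /eqP ->; rewrite addr0. Qed.

Lemma incZ a v c : inc a v -> inc a (c *: v).
Proof. by rewrite /inc -scalemxAl => /eqP ->; rewrite scaler0. Qed.

Lemma incZE a v c : c != 0 -> inc a (c *: v) = inc a v.
Proof. by move=> c0; rewrite /inc -scalemxAl scaler_eq0 (negPf c0). Qed.

Lemma rank_pair u v : u \in pts -> v \in pts -> u != v -> \rank (col_mx u v) = 2.
Proof.
move=> up vp uv; rewrite -addsmxE; apply/eqP.
have := mxrank_sum_cap u v; rewrite !rank_rV (pts_neq0 up) (pts_neq0 vp) /= => E.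
suff : \rank (u :&: v)%MS == 0 by move/eqP=> E0; rewrite E0 in E; apply/eqP; lia.
rewrite mxrank_eq0; apply: contraNT uv => c0.
have su : (u <= u :&: v)%MS.
  rewrite -(geq_leqif (mxrank_leqif_sup (capmxSl u v))).
  by rewrite rank_rV (pts_neq0 up) lt0n mxrank_eq0.
have /sub_rVP[c uE] := submx_trans su (capmxSr _ _).
by apply/eqP/(pts_scale up vp uE).
Qed.

(** Scaling acts freely on nonzero vectors, and each orbit meets [pts] once. *)
Lemma card_cone (S : {set V}) : 0 \notin S ->
    (forall c v, c != 0 -> v \in S -> c *: v \in S) ->
  #|S| = (q.-1 * #|S :&: pts|)%N.
Proof.
move=> S0 SZ; rewrite -sum1_card.
rewrite (partition_big first_coord (fun c => c != 0)) /=; last first.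
  by move=> v vS; rewrite first_coord_eq0; apply: contraNneq S0 => <-.
rewrite (eq_bigr (fun=> #|S :&: pts|)); last first.
  move=> c c0; rewrite sum1dep_card -(card_imset (pred_of_set (S :&: pts)) (scalerI c0)).
  apply: eq_card => v; rewrite inE; apply/andP/imsetP => [[vS /eqP vc]|[w]].
    exists (c^-1 *: v); last by rewrite scalerA mulfV // scale1r.
    by rewrite !inE SZ ?invr_eq0 //= first_coordZ ?invr_eq0 // vc mulVf.
  by rewrite !inE => /andP[wS /eqP w1] ->; rewrite SZ // first_coordZ // w1 mulr1.
by rewrite sum_nat_const -(@cardC1 F 0); congr muln; apply: eq_card.
Qed.

Lemma q_gt1 : (1 < q)%N.
Proof. exact: finNzRing_gt1. Qed.

Lemma card_pts : #|pts| = (q ^ 2 + q + 1)%N.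
Proof.
have := card_cone (S := ~: [set 0]); rewrite cardsC1 card_mx mul1n.
have -> : ~: [set 0] :&: pts = pts.
  by apply/setIidPr/subsetP => v /pts_neq0; rewrite !inE.
have S0 : 0 \notin ~: [set 0 : V] by rewrite !inE eqxx.
have SZ c v : c != 0 -> v \in ~: [set 0 : V] -> c *: v \in ~: [set 0].
  by move=> c0; rewrite !inE scaler_eq0 negb_or c0.
move=> /(_ S0 SZ) E; have := q_gt1; case: q E => [|[|r]] //= E _.
apply/eqP; rewrite -(@eqn_pmul2l r.+1) // -E; apply/eqP.
by rewrite !expnS expn0; nia.
Qed.

(** The kernel of A has dimension r, so q^r elements; zero is put apart. *)
Lemma card_kermx_pts m (A : 'M_(3, m)) r : \rank A = (3 - r)%N -> (r <= 3)%N ->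
  (q ^ r)%N = (q.-1 * #|[set v in pts | v *m A == 0]|).+1.
Proof.
move=> rA r3; have <- : #|rowg (kermx A)| = (q ^ r)%N.
  by rewrite card_rowg mxrank_ker rA; congr (_ ^ _)%N; lia.
have -> : rowg (kermx A) = 0 |: [set v | (v != 0) && (v *m A == 0)].
  apply/setP => v; rewrite !inE sub_kermx.
  by case: (eqVneq v 0) => [->|_] //=; rewrite mul0mx eqxx.
rewrite cardsU1 !inE eqxx /= add1n card_cone ?inE ?eqxx //; last first.
  move=> c v c0; rewrite !inE scaler_eq0 negb_or c0 /= -scalemxAl => /andP[-> /eqP ->].
  by rewrite scaler0 eqxx.
congr (_ * _).+1%N; apply: eq_card => v; rewrite !inE.
case: (boolP (first_coord v == 1)) => [v1|]; last by rewrite andbF.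
by rewrite andbT -first_coord_eq0 (eqP v1) oner_eq0.
Qed.

Definition line (a : V) : {set V} := [set v in pts | inc a v].

Lemma line_inc a v : v \in line a -> inc a v.
Proof. by rewrite inE => /andP[]. Qed.

Lemma line_pts a v : v \in line a -> v \in pts.
Proof. by rewrite inE => /andP[]. Qed.

Lemma card_line a : a != 0 -> #|line a| = q.+1.
Proof.
move=> a0; have /card_kermx_pts/(_ isT) : \rank a^T = (3 - 2)%N.
  by rewrite mxrank_tr rank_rV a0.
rewrite /line /inc; have := q_gt1; case: q => [|[|r]] //= _ [E].
apply/eqP; rewrite -(@eqn_pmul2l r.+1) // -E; apply/eqP.
by rewrite !expnS expn0; nia.
Qed.

Lemma card_join u v : u \in pts -> v \in pts -> u != v ->
  #|[set a in pts | inc a u && inc a v]| = 1%N.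
Proof.
move=> up vp uv; have /card_kermx_pts/(_ isT) : \rank (col_mx u v)^T = (3 - 1)%N.
  by rewrite mxrank_tr rank_pair.
have -> : [set w in pts | w *m (col_mx u v)^T == 0] = [set a in pts | inc a u && inc a v].
  apply/setP => a; rewrite !inE tr_col_mx mul_mx_row row_mx_eq0.
  by rewrite !(incC a).
have := q_gt1; case: q => [|[|r]] //= _ [E].
by apply/eqP; rewrite -(@eqn_pmul2l r.+1) // -E; apply/eqP; lia.
Qed.

Lemma line_span a u v w : a != 0 -> u \in line a -> v \in line a -> u != v ->
  inc a w -> exists x y, w = x *: u + y *: v.
Proof.
move=> a0 ul vl uv aw.
have : (w <= col_mx u v)%MS.
  have rk : \rank (col_mx u v) = 2 by rewrite rank_pair // (line_pts ul, line_pts vl).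
  have sk : (col_mx u v <= kermx a^T)%MS.
    by rewrite sub_kermx mul_col_mx (eqP (line_inc ul)) (eqP (line_inc vl)) col_mx0.
  have /eqmxP -> : (col_mx u v == kermx a^T)%MS.
    by rewrite -(geq_leqif (mxrank_leqif_eq sk)) rk mxrank_ker mxrank_tr rank_rV a0.
  by rewrite sub_kermx.
rewrite -addsmxE => /sub_addsmxP[[x y] /= ->].
exists (x 0 0), (y 0 0); rewrite [x]mx11_scalar [y]mx11_scalar.
by rewrite !mul_scalar_mx !mxE !eqxx !mulr1n.
Qed.

End Plane.

(** * Homogeneous polynomials and polar derivatives *)

Section MpolyGeneral.
Variables (n : nat) (F : fieldType).

Lemma mpoly_ring_ind (P : {mpoly F[n]} -> Prop) :
    (forall c, P c%:MP) -> (forall i, P 'X_i) ->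
    (forall f g, P f -> P g -> P (f + g)) ->
    (forall f g, P f -> P g -> P (f * g)) -> forall f, P f.
Proof.
move=> PC PX PD PM f; rewrite [f]mpolyE.
have P0 : P 0 by rewrite -mpolyC0; apply: PC.
apply: (big_ind P) => // m _; rewrite -mul_mpolyC; apply: (PM) => //.
rewrite mpolyXE_id; apply: (big_ind P) => [||i _]; [exact: (PC 1)|exact: PM|].
by elim: (m i) => [|k IHk]; [exact: (PC 1)|rewrite exprS; apply: PM].
Qed.

(** Multiplication by a homogeneous D shifts the homogeneous components of S,
    and kills none of them. *)
Lemma homog_quotient d e (D S : {mpoly F[n]}) : D != 0 -> D \is e.-homog ->
  D * S \is (e + d).-homog -> S \is d.-homog.
Proof.
move=> D0 hD hDS.
have key k : pihomog mdeg (e + k) (D * S) = D * pihomog mdeg k S.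
  rewrite {1}(pihomog_partitionE (leqnn (mmeasure mdeg S))) mulr_sumr linear_sum /=.
  have hom i : D * pihomog mdeg i S \is (e + i).-homog by rewrite dhomogM ?pihomogP.
  case: (ltnP k (mmeasure mdeg S)) => [lt_k|le_k].
    rewrite (bigD1 (Ordinal lt_k)) //= big1 ?addr0; first by rewrite pihomog_dE.
    move=> i /eqP ik; apply: pihomog_ne0 (hom i).
    by rewrite eqn_add2l; apply/eqP => E; apply: ik; apply: val_inj.
  rewrite big1 => [|i _]; last first.
    apply: pihomog_ne0 (hom i); rewrite eqn_add2l.
    by have := ltn_ord i; lia.
  have -> : pihomog mdeg k S = 0; last by rewrite mulr0.
  rewrite pihomogE big_seq_cond big1 // => m /andP[mS /eqP mk].
  by have := mmeasure_mnm_lt mdeg mS; lia.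
rewrite (pihomog_partitionE (leqnn (mmeasure mdeg S))).
apply: rpred_sum => i _; have [->|ne] := eqVneq (i : nat) d; first exact: pihomogP.
have : D * pihomog mdeg i S == 0.
  by rewrite -key (pihomog_ne0 _ hDS) // eqn_add2l eq_sym.
by rewrite mulf_eq0 (negPf D0) /= => /eqP ->; apply: rpred0.
Qed.

Definition polar (w : 'I_n -> F) (G : {mpoly F[n]}) : {mpoly F[n]} :=
  \sum_i w i *: mderiv i G.

Lemma mderiv_homog d i (G : {mpoly F[n]}) :
  G \is d.+1.-homog -> mderiv i G \is d.-homog.
Proof.
move=> /dhomogP hG; rewrite [G]mpolyE linear_sum /=.
rewrite big_seq_cond; apply: rpred_sum => m; rewrite andbT => mG.
rewrite linearZ /= mderivX; apply: rpredZ.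
case: (posnP (m i)) => [->|mi]; first by rewrite scale0r rpred0.
apply: rpredZ; rewrite dhomogX /= -(eqn_add2r 1) -{1}(mdeg1 i) -mdegD submK.
  by rewrite (hG m mG) addn1.
by rewrite lep1mP -lt0n.
Qed.

Lemma polar_homog d w (G : {mpoly F[n]}) :
  G \is d.+1.-homog -> polar w G \is d.-homog.
Proof. by move=> hG; apply: rpred_sum => i _; rewrite rpredZ // mderiv_homog. Qed.

(** Euler's identity, checked monomial by monomial. *)
Lemma euler d (G : {mpoly F[n]}) (v : 'I_n -> F) :
  G \is d.-homog -> (polar v G).@[v] = d%:R * G.@[v].
Proof.
move=> /dhomogP hG; rewrite /polar (raddf_sum (meval v)) /=.
have E i : (mderiv i G).@[v] =
    \sum_(m <- msupp G) G@_m * ((m i)%:R * ('X_[m - U_(i)]).@[v]).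
  rewrite /mderiv (raddf_sum (meval v)); apply: eq_bigr => m _ /=.
  by rewrite mevalZ -mulrA mulrCA.
under eq_bigr => i _ do rewrite mevalZ E mulr_sumr.
have -> : G.@[v] = \sum_(m <- msupp G) G@_m * ('X_[m]).@[v].
  rewrite {1}[G]mpolyE (raddf_sum (meval v)).
  by apply: eq_bigr => m _ /=; rewrite mevalZ.
rewrite mulr_sumr exchange_big /= !big_seq; apply: eq_bigr => m mG.
have hm : mdeg m = d by exact: hG.
rewrite -hm mdegE natr_sum mulr_suml; apply: eq_bigr => i _.
rewrite mulrCA [RHS]mulrCA; congr (_ * _).
case: (posnP (m i)) => [->|mi]; first by rewrite !mul0r mulr0.
rewrite mulrCA; congr (_ * _); rewrite -[X in X * _](mevalXU v i) -mevalM -mpolyXD.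
by rewrite addmC submK // lep1mP -lt0n.
Qed.

End MpolyGeneral.

(** * Restriction of a polynomial to a parametrized line *)

Section LinePoly.
Variables (n : nat) (F : fieldType) (R : comNzRingType) (h : {rmorphism F -> R}).

(** The polynomial G(v + X w).  The coefficients are moved along h so that the
    points v and w may have coordinates in a larger ring: this is used over F,
    over L and over polynomial rings. *)
Definition line_poly (v w : 'I_n -> R) (G : {mpoly F[n]}) : {poly R} :=
  mmap (polyC \o h) (fun i => (v i)%:P + w i *: 'X) G.

Lemma horner_line_poly v w G t :
  (line_poly v w G).[t] = mmap h (fun i => v i + w i * t) G.
Proof.
elim/mpoly_ring_ind: G => [c|i|f g IHf IHg|f g IHf IHg] /=.
- by rewrite /line_poly !mmapC /= hornerC.
- by rewrite /line_poly !mmapX !mmap1U hornerD hornerC hornerZ hornerX.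
- by rewrite /line_poly !raddfD /= hornerD -!/(line_poly _ _ _) IHf IHg.
- by rewrite /line_poly !rmorphM /= hornerM -!/(line_poly _ _ _) IHf IHg.
Qed.

Let hom_like (d : nat) (c : R) (f : {poly R}) := (size f <= d.+1)%N /\ f`_d = c.

Let hom_likeM d e c b f g : hom_like d c f -> hom_like e b g ->
  hom_like (d + e) (c * b) (f * g).
Proof.
move=> [sf fd] [sg ge]; split.
  by apply: leq_trans (size_polyMleq _ _) _; move: sf sg; case: (size f) => [|a]; lia.
rewrite coefM (bigD1 (inord d)) //= inordK ?ltnS ?leq_addr // fd addKn ge.
rewrite big1 ?addr0 // => i ne; have [lt_id|le_di] := ltnP i d.
  rewrite [g`__]nth_default ?mulr0 //; apply: leq_trans sg _.
  by have := ltn_ord i; lia.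
rewrite [f`__]nth_default ?mul0r //; apply: leq_trans sf _.
move: ne; rewrite -val_eqE /= inordK; last by have := ltn_ord i; lia.
by lia.
Qed.

(** The coefficient of X^d is the value at w, the point at infinity of the
    parametrized line; so the degree drops exactly when w is a zero. *)
Lemma line_poly_homog d v w G : G \is d.-homog ->
  (size (line_poly v w G) <= d.+1)%N /\ (line_poly v w G)`_d = mmap h w G.
Proof.
move=> /dhomogP hG; rewrite /line_poly /mmap -/(hom_like d _ _).
rewrite big_seq [X in hom_like _ _ X]big_seq.
apply: (big_rec2 (fun c f => hom_like d c f)).
  by rewrite /hom_like size_poly0 coef0.
move=> m c f mG [sf fd].
suff [s1 s2] : hom_like d (h G@_m * mmap1 w m)
    ((polyC \o h) G@_m * mmap1 (fun i => (v i)%:P + w i *: 'X) m).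
  split; last by rewrite coefD fd s2.
  by rewrite (leq_trans (size_polyD _ _)) // geq_max sf s1.
rewrite -[d]add0n; apply: hom_likeM.
  by split; [rewrite size_polyC; case: (_ != 0)|rewrite coefC].
have hm : mdeg m = d by exact: hG.
rewrite -hm mdegE /mmap1.
apply: (big_rec3 (fun k c f => hom_like k c f)).
  by split; rewrite ?size_poly1 // coef1.
move=> i k b g _ IH; apply: hom_likeM => //.
elim: (m i) => [|j IHj]; first by split; rewrite ?expr0 ?size_poly1 // coef1.
rewrite !exprS -add1n; apply: hom_likeM => //; split.
  rewrite (leq_trans (size_polyD _ _)) // geq_max size_polyC.
  by rewrite (leq_trans (size_scale_leq _ _)) ?size_polyX //; case: (_ != 0).
by rewrite coefD coefC coefZ coefX mulr1 add0r.
Qed.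

End LinePoly.

Lemma mmap_idfun n (F : fieldType) (v : 'I_n -> F) G : mmap idfun v G = G.@[v].
Proof. by []. Qed.

(** The chain rule. *)
Lemma deriv_line_poly n (F : fieldType) (v w : 'I_n -> F) G :
  deriv (line_poly idfun v w G) = line_poly idfun v w (polar w G).
Proof.
rewrite /line_poly; set M := mmap _ _.
have MC c : M c%:MP = c%:P by rewrite /M mmapC.
have MX i : M 'X_i = (v i)%:P + w i *: 'X by rewrite /M mmapX mmap1U.
have MD : {morph M : f g / f + g} by apply: raddfD.
have MM : {morph M : f g / f * g} by apply: rmorphM.
elim/mpoly_ring_ind: G => [c|i|f g IHf IHg|f g IHf IHg].
- rewrite MC derivC /polar big1 ?raddf0 ?/M ?mmap0 // => i _.
  by rewrite mderivC scaler0.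
- rewrite MX derivD derivC derivZ derivX add0r.
  rewrite /polar (bigD1 i) //= big1 ?addr0 => [|j ji].
    rewrite mderivX mnm1E eqxx scale1r -[X in (X - _)%MM]add0m addmK mpolyX0 -mul_mpolyC mulr1 MC.
    by rewrite alg_polyC.
  by rewrite mderivX mnm1E eq_sym (negPf ji) scale0r scaler0.
- rewrite MD derivD IHf IHg -MD; congr M; rewrite /polar -big_split /=.
  by apply: eq_bigr => i _; rewrite mderivD scalerDr.
- rewrite MM derivM IHf IHg -!MM -MD; congr M; rewrite /polar.
  rewrite mulr_suml mulr_sumr -big_split /=; apply: eq_bigr => i _.
  by rewrite mderivM scalerDr scalerAl scalerAr.
Qed.

(** * Double roots of univariate polynomials *)

Section DoubleRoots.
Variable F : fieldType.

(** A root of the derivative is a root at least twice. *)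
Lemma double_roots (f : {poly F}) (A B : seq F) : f != 0 -> uniq A -> uniq B ->
    {subset B <= A} -> {in A, forall t, root f t} -> {in B, forall t, root f^`() t} ->
  exists g : {poly F}, f = g * \prod_(t <- A) ('X - t%:P) * \prod_(t <- B) ('X - t%:P).
Proof.
move=> f0 uA uB sBA rA rB.
have [g fE] : exists g, f = g * \prod_(t <- A) ('X - t%:P).
  by apply: uniq_roots_prod_XsubC; [apply/allP|rewrite uniq_rootsE].
have rg : all (root g) B.
  apply/allP => t tB; have := rB t tB; rewrite fE (big_rem t) ?sBA //= mulrCA.
  rewrite derivM derivXsubC mul1r /root hornerD !hornerM hornerXsubC subrr mul0r addr0.
  rewrite mulf_eq0 -!rootE => /orP[//|r].
  have : t \in rem t A by rewrite -root_prod_XsubC.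
  by rewrite mem_rem_uniq // inE eqxx.
have [|k gE] := uniq_roots_prod_XsubC rg; first by rewrite uniq_rootsE.
by exists k; rewrite fE {1}gE mulrAC.
Qed.

Lemma count_double_roots (f : {poly F}) (A B : seq F) d : f != 0 ->
    (size f <= d.+1)%N -> uniq A -> uniq B ->
    {subset B <= A} -> {in A, forall t, root f t} -> {in B, forall t, root f^`() t} ->
  (size A + size B <= d)%N.
Proof.
move=> f0 sf uA uB sBA rA rB; have [g fE] := double_roots f0 uA uB sBA rA rB.
have g0 : g != 0 by apply: contraNneq f0 => g0; rewrite fE g0 !mul0r.
move: sf; rewrite fE -mulrA -big_cat /=.
rewrite size_Mmonic ?monic_prod_XsubC // size_prod_XsubC size_cat.
by move: g0; rewrite -size_poly_gt0; lia.
Qed.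

End DoubleRoots.

(** * Ternary forms and the lines they contain *)

Section Forms.
Variable F : finFieldType.
Notation V := 'rV[F]_3.
Notation q := #|F|.
Notation form d G := (is_true (G \is d.-homog)).
Implicit Types (G : {mpoly F[3]}) (u v w : V).

Definition ev G v : F := G.@[v 0].

Lemma evZ d G c v : form d G -> ev G (c *: v) = c ^+ d * ev G v.
Proof.
move=> /dhomogP hG; rewrite /ev !mevalE mulr_sumr !big_seq.
apply: eq_bigr => m mG; rewrite mulrCA; congr (_ * _).
have hm : mdeg m = d by exact: hG.
rewrite -hm mdegE -prodrXr -big_split /=; apply: eq_bigr => i _.
by rewrite mxE exprMn.
Qed.

Lemma evD G H v : ev (G + H) v = ev G v + ev H v. Proof. exact: mevalD. Qed.
Lemma evM G H v : ev (G * H) v = ev G v * ev H v. Proof. exact: mevalM. Qed.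

Definition zeros G : {set V} := [set v in pts F | ev G v == 0].

Definition linform (a : V) : {mpoly F[3]} := \sum_i a 0 i *: 'X_i.

Lemma linform_homog a : form 1 (linform a).
Proof. by apply: rpred_sum => i _; rewrite rpredZ // dhomogX /= mdeg1. Qed.

Lemma ev_linform a v : ev (linform a) v = \sum_i a 0 i * v 0 i.
Proof.
rewrite /ev /linform (raddf_sum (meval _)); apply: eq_bigr => i _ /=.
by rewrite mevalZ mevalXU.
Qed.

Lemma inc_ev a v : inc a v = (ev (linform a) v == 0).
Proof.
rewrite ev_linform /inc; apply/eqP/eqP => [/matrixP/(_ 0 0)|E].
  by rewrite !mxE => E; rewrite -[RHS]E; apply: eq_bigr => i _; rewrite mxE mulrC.
apply/matrixP => i j; rewrite !ord1 !mxE -[RHS]E.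
by apply: eq_bigr => k _; rewrite mxE mulrC.
Qed.

Lemma line_zeros a : line a = zeros (linform a).
Proof. by apply/setP => v; rewrite !inE inc_ev. Qed.

Lemma linform_neq0 a : a != 0 -> linform a != 0.
Proof.
apply: contraNneq => a0; apply/eqP/rowP => i; rewrite mxE.
have := congr1 (fun G => G@_U_(i)) a0; rewrite mcoeff0 /linform raddf_sum /=.
rewrite (bigD1 i) //= mcoeffZ mcoeffXU eqxx mulr1 big1 ?addr0 // => j ji.
by rewrite mcoeffZ mcoeffXU (negPf ji) mulr0.
Qed.

Lemma line_poly_eq0 (R : idomainType) (h : {rmorphism F -> R}) d G (v w : 'I_3 -> R) :
    form d G -> (d <= q)%N -> mmap h w G = 0 ->
    (forall c, mmap h (fun i => v i + w i * h c) G = 0) -> line_poly h v w G = 0.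
Proof.
move=> hG dq Gw Gv; have [sz cf] := line_poly_homog h v w hG.
have sz' : (size (line_poly h v w G) <= d)%N.
  rewrite leqNgt; apply/negP => lt; have E : size (line_poly h v w G) = d.+1 by lia.
  have : lead_coef (line_poly h v w G) = 0 by rewrite lead_coefE E /= cf.
  by move/eqP; rewrite lead_coef_eq0 -size_poly_eq0 E.
apply/eqP; apply/negPn/negP => nz.
have uq : uniq [seq h c | c <- enum F].
  by rewrite map_inj_uniq ?enum_uniq //; apply: fmorph_inj.
have rt : all (root (line_poly h v w G)) [seq h c | c <- enum F].
  by apply/allP => _ /mapP[c _ ->]; rewrite /root horner_line_poly Gv.
have := max_poly_roots nz rt uq; rewrite size_map -cardE => lt.
by have := leq_trans lt sz'; rewrite ltnNge dq.
Qed.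

(** A form of degree at most q may have degree q in one variable, so counting
    roots variable by variable does not suffice; but the coefficient of the
    q-th power of a variable is the value at a coordinate point, and is zero.
    One constant after the other is then replaced by an indeterminate. *)
Lemma form_eq0 d G : form d G -> (d <= q)%N -> (forall v, ev G v = 0) -> G = 0.
Proof.
move=> hG dq G0.
pose P (x y z : {mpoly F[3]}) := fun i : 'I_3 => nth 0 [:: x; y; z] i.
have mC (v w : 'I_3 -> {mpoly F[3]}) : v =1 w ->
    mmap (@mpolyC 3 F) v G = mmap (@mpolyC 3 F) w G.
  by move=> vw; apply: eq_bigr => m _; congr (_ * _); apply: eq_bigr => i _; rewrite vw.
(* P x y z is the point with these coordinates; they are constants here, and
   become indeterminates one at a time in the three steps that follow *)
have cst (x y z : F) : mmap (@mpolyC 3 F) (P x%:MP y%:MP z%:MP) G = 0.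
  have := G0 (\row_i nth 0 [:: x; y; z] i).
  rewrite /ev mevalE => E; have := congr1 (@mpolyC 3 F) E.
  rewrite mpolyC0 raddf_sum /= => <-; apply: eq_bigr => m _.
  rewrite rmorphM; congr (_ * _); rewrite rmorph_prod; apply: eq_bigr => i _.
  rewrite mxE rmorphXn /=; congr (_ ^+ _); rewrite /P.
  by case: i => [[|[|[|i]]] lti].
have step (v w : 'I_3 -> {mpoly F[3]}) x : mmap (@mpolyC 3 F) w G = 0 ->
    (forall c : F, mmap (@mpolyC 3 F) (fun i => v i + w i * c%:MP) G = 0) ->
  mmap (@mpolyC 3 F) (fun i => v i + w i * x) G = 0.
  by move=> Gw Gv; rewrite -horner_line_poly (line_poly_eq0 hG dq Gw Gv) horner0.
have ord3 (Q : 'I_3 -> Prop) : Q 0 -> Q 1 -> Q 2%:R -> forall i, Q i.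
  move=> Q0 Q1 Q2 [[|[|[|i]]] lti] //.
  - by have -> : Ordinal lti = 0 by apply: val_inj.
  - by have -> : Ordinal lti = 1 by apply: val_inj.
  - by have -> : Ordinal lti = 2%:R by apply: val_inj.
have s1 (x y : F) z : mmap (@mpolyC 3 F) (P x%:MP y%:MP z) G = 0.
  rewrite (mC _ (fun i => P x%:MP y%:MP 0 i + P 0 0 1 i * z)).
    apply: step => [|c]; first exact: (cst 0 0 1).
    rewrite (mC _ (P x%:MP y%:MP c%:MP)) //.
    by apply: ord3; rewrite /P /= ?mul0r ?addr0 // mul1r add0r.
  by apply: ord3; rewrite /P /= ?mul0r ?addr0 // mul1r add0r.
have s2 (x : F) y z : mmap (@mpolyC 3 F) (P x%:MP y z) G = 0.
  rewrite (mC _ (fun i => P x%:MP 0 z i + P 0 1 0 i * y)).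
    apply: step => [|c]; first exact: (cst 0 1 0).
    rewrite (mC _ (P x%:MP c%:MP z)) //.
    by apply: ord3; rewrite /P /= ?mul0r ?addr0 // mul1r add0r.
  by apply: ord3; rewrite /P /= ?mul0r ?addr0 // mul1r add0r.
have s3 x y z : mmap (@mpolyC 3 F) (P x y z) G = 0.
  rewrite (mC _ (fun i => P 0 y z i + P 1 0 0 i * x)).
    apply: step => [|c]; first exact: (cst 1 0 0).
    rewrite (mC _ (P c%:MP y z)) //.
    by apply: ord3; rewrite /P /= ?mul0r ?addr0 // mul1r add0r.
  by apply: ord3; rewrite /P /= ?mul0r ?addr0 // mul1r add0r.
rewrite [G]mpolyE -[RHS](s3 'X_0 'X_1 'X_2%:R); apply: eq_bigr => m _.
rewrite -mul_mpolyC mpolyXE_id; congr (_ * _); apply: eq_bigr => i _.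
by congr (_ ^+ _); move: i; apply: ord3.
Qed.

(** Congruence modulo D is compatible with the ring operations, so it is enough
    to check it on the variables. *)
Lemma subst_congr (phi : {rmorphism {mpoly F[3]} -> {mpoly F[3]}}) (D : {mpoly F[3]}) G :
    (forall c, phi c%:MP = c%:MP) -> (forall i, exists H, 'X_i = phi 'X_i + D * H) ->
  exists H, G = phi G + D * H.
Proof.
move=> pC pX; elim/mpoly_ring_ind: G => [c|//|f g [H fE] [K gE]|f g [H fE] [K gE]].
- by exists 0; rewrite pC mulr0 addr0.
- by exists (H + K); rewrite {1}fE {1}gE rmorphD; ring.
- by exists (phi f * K + H * phi g + D * H * K); rewrite {1}fE {1}gE rmorphM; ring.
Qed.

(** Project the space onto the plane of equation a along a vector b outside it.
    The projected form agrees with G modulo the equation of the plane; it takes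
    only values of G on that plane, so it is zero. *)
Lemma line_factor d G a : form d.+1 G -> (d < q)%N -> a != 0 ->
  line a \subset zeros G -> exists2 H, form d H & G = linform a * H.
Proof.
move=> hG dq a0 sub.
have zero v : inc a v -> ev G v = 0.
  have [->|v0] := eqVneq v 0.
    by rewrite -(scale0r 0) (evZ _ _ hG) expr0n mul0r.
  move=> av; have /subsetP/(_ (normalize v)) := sub.
  rewrite !inE /= (evZ _ _ hG) /normalize incZE ?invr_eq0 ?first_coord_eq0 // av.
  have := normalize_pts v0; rewrite inE => -> /(_ isT) /=.
  by rewrite mulf_eq0 expf_eq0 /= invr_eq0 first_coord_eq0 (negPf v0) => /eqP.
have [b ab] : exists b, ev (linform a) b = 1.
  have /rV0Pn[i ai] := a0.
  exists (\row_j ((a 0 i)^-1 *+ (j == i))); rewrite ev_linform (bigD1 i) //= big1.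
    by rewrite mxE eqxx mulr1n mulfV // addr0.
  by move=> j ji; rewrite mxE (negPf ji) mulr0n mulr0.
(* the projection v |-> v - a(v) b, as a substitution *)
pose s i := 'X_i - (b 0 i)%:MP * linform a.
pose phi : {rmorphism {mpoly F[3]} -> {mpoly F[3]}} := mmap (@mpolyC 3 F) s.
have [||H GE] := @subst_congr phi (linform a) G.
- by move=> c; rewrite /phi /= mmapC.
- by move=> i; exists (b 0 i)%:MP; rewrite /phi /= mmapX mmap1U /s; ring.
have pG : phi G = 0.
  apply: (@form_eq0 d.+1) => // [|v].
    have hs i : form 1 (s i).
      rewrite rpredB ?dhomogX /= ?mdeg1 //.
      by rewrite mul_mpolyC rpredZ // linform_homog.
    rewrite /phi /= /mmap big_seq; apply: rpred_sum => m mG.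
    rewrite /= mul_mpolyC rpredZ // /mmap1.
    have hm : mdeg m = d.+1 by have /dhomogP := hG; apply.
    rewrite -hm mdegE; apply: (big_rec2 (fun k f => form k f)); first exact: dhomog1.
    move=> i k f _; apply: dhomogM.
    by have := dhomogMn (m i) (hs i); rewrite mul1n.
  have -> : ev (phi G) v = ev G (v - ev (linform a) v *: b).
    rewrite /ev; elim/mpoly_ring_ind: (G) => [c|i|f g IHf IHg|f g IHf IHg].
    - by rewrite /phi /= mmapC !mevalC.
    - rewrite /phi /= mmapX mmap1U /s mevalB mevalM mevalC !mevalXU !mxE.
      by rewrite mulrC.
    - by rewrite rmorphD /= !mevalD IHf IHg.
    - by rewrite rmorphM /= !mevalM IHf IHg.
  apply: zero; rewrite inc_ev ev_linform.
  under eq_bigr => i _ do rewrite !mxE mulrBr.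
  rewrite sumrB -ev_linform; under [X in _ - X]eq_bigr => i _ do rewrite mulrCA.
  by rewrite -mulr_sumr -ev_linform ab mulr1 subrr.
rewrite pG add0r in GE; exists H => //.
by apply: (homog_quotient (linform_neq0 a0) (linform_homog a)); rewrite -GE.
Qed.

End Forms.

(** * Counting incidences between a point set and the lines *)

Section DoubleCounting.
Variable F : finFieldType.
Notation V := 'rV[F]_3.
Notation q := #|F|.
Notation pts := (pts F).
Implicit Types (S : {set V}).

Lemma line_sym a v : a \in pts -> v \in pts -> (v \in line a) = (a \in line v).
Proof. by move=> ap vp; rewrite !inE incC; move: ap vp; rewrite !inE => -> ->. Qed.

Lemma sum_line S : S \subset pts ->
  (\sum_(a in pts) #|line a :&: S| = #|S| * q.+1)%N.
Proof.
move=> /subsetP sS.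
transitivity (\sum_(a in pts) \sum_(v in S) (v \in line a))%N.
  apply: eq_bigr => a _; rewrite -sum1_card big_mkcond /= [RHS]big_mkcond /=.
  by apply: eq_bigr => v _; rewrite inE; case: (v \in S); case: (v \in line a).
rewrite exchange_big /= -sum_nat_const; apply: eq_bigr => v vS.
rewrite -(card_line (pts_neq0 (sS v vS))) -sum1_card big_mkcond /= [RHS]big_mkcond.
apply: eq_bigr => a _; case: (boolP (a \in pts)) => ap.
  by rewrite (line_sym ap (sS v vS)); case: (_ \in _).
by case: (boolP (a \in line v)) => // /line_pts; rewrite (negPf ap).
Qed.

(** Two distinct points lie on one common line, and a point lies on q + 1
    lines. *)
Lemma sum_line_sq S : S \subset pts ->
  (\sum_(a in pts) #|line a :&: S| ^ 2 = #|S| * (q + #|S|))%N.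
Proof.
move=> /subsetP sS.
transitivity (\sum_(a in pts) \sum_(v in S) \sum_(u in S)
    (v \in line a) * (u \in line a))%N.
  apply: eq_bigr => a _.
  have -> : #|line a :&: S| = (\sum_(v in S) (v \in line a))%N.
    rewrite -sum1_card big_mkcond /= [RHS]big_mkcond /=.
    by apply: eq_bigr => v _; rewrite inE; case: (v \in S); case: (v \in line a).
  by rewrite -mulnn big_distrlr.
rewrite exchange_big /= -sum_nat_const; apply: eq_bigr => v vS.
rewrite exchange_big /= (bigD1 v) //=.
have -> : (\sum_(a in pts) (v \in line a) * (v \in line a) = q.+1)%N.
  rewrite -(card_line (pts_neq0 (sS v vS))) -sum1_card big_mkcond /= [RHS]big_mkcond.
  apply: eq_bigr => a _; case: (boolP (a \in pts)) => ap.
    by rewrite (line_sym ap (sS v vS)); case: (_ \in _).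
  by case: (boolP (a \in line v)) => // /line_pts; rewrite (negPf ap).
rewrite (eq_bigr (fun=> 1%N)) => [|u /andP[uS uv]]; last first.
  rewrite eq_sym in uv; have J := card_join (sS v vS) (sS u uS) uv.
  apply: etrans J; rewrite -sum1_card.
  rewrite big_mkcond /= [RHS]big_mkcond; apply: eq_bigr => a _.
  rewrite !inE; case: (first_coord a == 1) => //=.
  have := sS v vS; have := sS u uS; rewrite !inE => -> -> /=.
  by case: (inc a v); case: (inc a u).
rewrite sum1dep_card (cardsD1 v S) vS addSn add1n addnS; congr (_ + _).+1%N.
by apply: eq_card => u; rewrite !inE andbC.
Qed.

(** One of the two complementary numbers n and d - n is at least half of d, and
    the other one is at least t. *)
Lemma product_bound (d n t : nat) : (t <= n)%N -> (n + t <= d)%N ->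
  (uphalf d * t <= n * (d - n))%N.
Proof.
move=> tn ntd; have [le_cn|lt_nc] := leqP (uphalf d) n.
  by rewrite leq_mul //; lia.
by rewrite mulnC leq_mul //; lia.
Qed.

Variables (S : {set V}) (d : nat) (t : V -> nat).
Hypothesis sS : S \subset pts.
Hypothesis tn : forall a, a \in pts -> (t a <= #|line a :&: S|)%N.
Hypothesis ntd : forall a, a \in pts -> (#|line a :&: S| + t a <= d)%N.
Hypothesis St : (#|S| <= \sum_(a in pts) t a)%N.

Let deficit_sum : (\sum_(a in pts) #|line a :&: S| * (d - #|line a :&: S|)
  + #|S| * (q + #|S|) = #|S| * (d * q.+1))%N.
Proof.
rewrite -(sum_line_sq sS) -big_split /= mulnCA -(sum_line sS) big_distrr /=.
apply: eq_bigr => a /ntd H; rewrite -mulnn -mulnDr subnK 1?mulnC //.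
by apply: leq_trans H; rewrite leq_addr.
Qed.

Lemma deficit_bound : (0 < #|S|)%N -> (#|S| + uphalf d + q <= d * q.+1)%N.
Proof.
move=> S0; rewrite -(leq_pmul2l S0) -deficit_sum.
have : (uphalf d * #|S| <= \sum_(a in pts) #|line a :&: S| * (d - #|line a :&: S|))%N.
  apply: (@leq_trans (\sum_(a in pts) uphalf d * t a)).
    by rewrite -big_distrr leq_mul2l St orbT.
  by apply: leq_sum => a ap; rewrite product_bound ?tn ?ntd.
by nia.
Qed.

(** When the bound is attained, every inequality used for it is an equality. *)
Lemma deficit_eq : (#|S| + uphalf d + q = d * q.+1)%N -> (0 < d)%N ->
  (\sum_(a in pts) t a = #|S|)%N /\
  {in pts, forall a, #|line a :&: S| * (d - #|line a :&: S|) = uphalf d * t a}%N.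
Proof.
move=> E d0.
have A : (uphalf d * #|S| <= \sum_(a in pts) uphalf d * t a)%N.
  by rewrite -big_distrr leq_mul2l St orbT.
have B : (\sum_(a in pts) uphalf d * t a
    <= \sum_(a in pts) #|line a :&: S| * (d - #|line a :&: S|) ?= iff
    [forall (a | a \in pts), uphalf d * t a == #|line a :&: S| * (d - #|line a :&: S|)])%N.
  apply: leqif_sum => a ap; split => //.
  by rewrite product_bound ?tn ?ntd.
have C : (\sum_(a in pts) #|line a :&: S| * (d - #|line a :&: S|) = uphalf d * #|S|)%N.
  by have := deficit_sum; rewrite -E; nia.
case: B => B1 B2; rewrite C in B1 B2.
have D : (\sum_(a in pts) uphalf d * t a = uphalf d * #|S|)%N by lia.
move: B2; rewrite D eqxx => /esym/forall_inP B2; split; last first.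
  by move=> a /B2/eqP.
have u0 : (0 < uphalf d)%N by case: (d) d0.
by move: D; rewrite -big_distrr /= => /eqP; rewrite eqn_pmul2l // => /eqP.
Qed.

End DoubleCounting.

(** * Rational points of a plane curve without rational lines *)

Section Curves.
Variable F : finFieldType.
Notation V := 'rV[F]_3.
Notation q := #|F|.
Notation pts := (pts F).
Notation form d G := (is_true (G \is d.-homog)).
Implicit Types (G : {mpoly F[3]}) (u v w a : V).

(** Tangency of the line a at a zero v of G, in the sense that G vanishes to
    order at least 2 along a at v.  At a singular point every line through it
    is tangent. *)
Definition tangent G a v : bool := [forall u in line a, ev (polar (u 0) G) v == 0].

Definition tangency G a : {set V} := [set v in line a :&: zeros G | tangent G a v].

Lemma normalizeZ c v : c != 0 -> normalize (c *: v) = normalize v.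
Proof.
move=> c0; rewrite /normalize first_coordZ // scalerA invfM mulrAC mulVf // mul1r //.
Qed.

Lemma ev_polarD x y u w G v :
  ev (polar ((x *: u + y *: w) 0) G) v = x * ev (polar (u 0) G) v + y * ev (polar (w 0) G) v.
Proof.
rewrite /ev /polar !(raddf_sum (meval _)) !mulr_sumr -big_split /=.
by apply: eq_bigr => i _; rewrite !mevalZ !mxE mulrDl !mulrA.
Qed.

Lemma ev_polar_self d G v : form d G -> ev (polar (v 0) G) v = d%:R * ev G v.
Proof. exact: euler. Qed.

Lemma zeros_sub G : zeros G \subset pts.
Proof. by apply/subsetP => v; rewrite inE => /andP[]. Qed.

Lemma in_line a v : (v \in line a) = (v \in pts) && inc a v.
Proof. by rewrite inE. Qed.

Lemma in_tangency G a v : (v \in tangency G a) = [&& v \in line a, v \in zeros G & tangent G a v].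
Proof. by rewrite inE in_setI andbA. Qed.

Lemma zeros_ev G v : v \in zeros G -> ev G v = 0.
Proof. by rewrite inE => /andP[_ /eqP]. Qed.

Section Restrict.
Variables (d : nat) (G : {mpoly F[3]}) (a v0 w : V).
Hypotheses (hG : form d.+1 G) (a0 : a != 0) (v0a : v0 \in line a) (wa : w \in line a).
Hypotheses (v0w : v0 != w) (Gw : ev G w != 0).

Let f := line_poly idfun (v0 0) (w 0) G.
Definition line_roots := [seq t <- enum F | root f t].
Definition double_line_roots := [seq t <- enum F | root f t && root f^`() t].

Lemma horner_line H t : (line_poly idfun (v0 0) (w 0) H).[t] = ev H (v0 + t *: w).
Proof.
by rewrite horner_line_poly mmap_idfun; apply: meval_eq => i; rewrite !mxE mulrC.
Qed.

Lemma size_line_poly : (size f <= d.+2)%N.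
Proof. by have [] := line_poly_homog idfun (v0 0) (w 0) hG. Qed.

Lemma line_poly_neq0 : f != 0.
Proof.
have [_ E] := line_poly_homog idfun (v0 0) (w 0) hG.
by apply: contraNneq Gw => f0; move: E; rewrite -/f f0 coef0 mmap_idfun => /esym/eqP.
Qed.

Let param u : u \in line a -> ev G u = 0 ->
  exists x t, x != 0 /\ v0 + t *: w = x^-1 *: u.
Proof.
move=> ua Gu; have [x [y uE]] := line_span a0 v0a wa v0w (line_inc ua).
have x0 : x != 0.
  apply: contraNneq Gw => x0; rewrite -(@pts_scale _ u w y) ?Gu //.
  - exact: line_pts ua.
  - exact: line_pts wa.
  - by rewrite uE x0 scale0r add0r.
exists x, (x^-1 * y); split=> //.
by rewrite uE scalerDr !scalerA mulVf // scale1r.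
Qed.

Lemma card_zeros_line_roots : (#|line a :&: zeros G| <= size line_roots)%N.
Proof.
have /card_uniqP <- : uniq line_roots by rewrite filter_uniq // enum_uniq.
apply: leq_trans (leq_imset_card (fun t => normalize (v0 + t *: w)) _).
apply: subset_leq_card; apply/subsetP => u /setIP[ua /zeros_ev Gu].
have [x [t [x0 tE]]] := param ua Gu.
apply/imsetP; exists t; last by rewrite tE normalizeZ ?invr_eq0 // normalize_id // (line_pts ua).
by rewrite mem_filter mem_enum andbT /root horner_line tE (evZ _ _ hG) Gu mulr0.
Qed.

Lemma card_tangency_double_roots : (#|tangency G a| <= size double_line_roots)%N.
Proof.
have /card_uniqP <- : uniq double_line_roots by rewrite filter_uniq // enum_uniq.
apply: leq_trans (leq_imset_card (fun t => normalize (v0 + t *: w)) _).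
apply: subset_leq_card; apply/subsetP => u; rewrite inE.
move=> /andP[/setIP[ua /zeros_ev Gu] /forall_inP tu].
have [x [t [x0 tE]]] := param ua Gu.
apply/imsetP; exists t; last by rewrite tE normalizeZ ?invr_eq0 // normalize_id // (line_pts ua).
rewrite mem_filter mem_enum andbT /root deriv_line_poly !horner_line tE (evZ _ _ hG) Gu mulr0 eqxx /=.
by rewrite (evZ _ _ (polar_homog _ hG)) (eqP (tu w wa)) mulr0.
Qed.

Lemma line_roots_bound : (size line_roots + size double_line_roots <= d.+1)%N.
Proof.
apply: (count_double_roots line_poly_neq0 size_line_poly).
- by rewrite filter_uniq // enum_uniq.
- by rewrite filter_uniq // enum_uniq.
- by move=> t; rewrite !mem_filter => /andP[/andP[-> _] ->].
- by move=> t; rewrite mem_filter => /andP[].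
- by move=> t; rewrite mem_filter => /andP[/andP[]].
Qed.

(** If all the d roots, counted with multiplicity, are double roots, then the
    restriction of G to the line is a constant times a square; in characteristic
    2 its derivative is then identically zero. *)
Lemma polar_eq0_all_double k : d.+1 = k.*2 -> #|line a :&: zeros G| = k -> #|tangency G a| = k ->
  2%:R = 0 :> F -> ev (polar (w 0) G) v0 = 0.
Proof.
move=> dk nk tk ch2.
have := card_zeros_line_roots; have := card_tangency_double_roots; have := line_roots_bound.
rewrite nk tk => b1 b2 b3.
have [sA sB] : size line_roots = k /\ size double_line_roots = k by lia.
have uA : uniq line_roots by rewrite filter_uniq // enum_uniq.
have uB : uniq double_line_roots by rewrite filter_uniq // enum_uniq.
have sBA : {subset double_line_roots <= line_roots}.
  by move=> t; rewrite !mem_filter => /andP[/andP[-> _] ->].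
have [|t|g fE] := double_roots line_poly_neq0 uA uB sBA.
- by move=> t; rewrite mem_filter => /andP[].
- by rewrite mem_filter => /andP[/andP[]].
have pe : perm_eq double_line_roots line_roots.
  by apply: uniq_perm => //; apply: (uniq_min_size uB sBA _).2; rewrite sA sB.
move: fE; rewrite (perm_big _ pe) /= -mulrA; set P := \prod_(_ <- _) _ => fE.
have g0 : g != 0 by apply: contraNneq line_poly_neq0 => g0; rewrite fE g0 mul0r.
have Pm : P \is monic by apply: monic_prod_XsubC.
have sg : (size g <= 1)%N.
  have := size_line_poly; rewrite fE size_Mmonic ?rpredM //.
  rewrite size_Mmonic ?monic_neq0 // /P size_prod_XsubC sA.
  have : (0 < size (g : {poly F}))%N by rewrite size_poly_gt0.
  by move: dk; clear; move: (size _) => s; lia.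
have : f^`() = 0.
  rewrite fE (size1_polyC sg) mul_polyC derivZ derivM mulrC -mulr2n.
  by rewrite -mulr_natl -polyC_natr ch2 mul0r scaler0.
rewrite deriv_line_poly => f0; have := horner_line (polar (w 0) G) 0.
by rewrite f0 horner0 scale0r addr0.
Qed.

End Restrict.

Lemma other_on_line a w : a \in pts -> exists2 v, v \in line a & v != w.
Proof.
move=> ap; have : (0 < #|line a :\ w|)%N.
  have := cardsD1 w (line a); rewrite (card_line (pts_neq0 ap)).
  have := q_gt1 F; case: (w \in line a) => /=.
    by rewrite add1n => q1 [<-]; apply: ltnW.
  by rewrite add0n => _ <-.
by case/card_gt0P => v /setD1P[vw va]; exists v.
Qed.

(** Points of tangency are double roots.  The restriction to a line not contained
    in the curve has exact degree d + 1 once the point at infinity of the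
    parametrization is taken off the curve. *)
Lemma line_bound d G a : form d.+1 G -> a \in pts -> ~~ (line a \subset zeros G) ->
  (#|line a :&: zeros G| + #|tangency G a| <= d.+1)%N.
Proof.
move=> hG ap /subsetPn[w wa wZ].
have Gw : ev G w != 0 by move: wZ; rewrite inE (line_pts wa).
have [v va vw] := other_on_line w ap.
apply: leq_trans (line_roots_bound v hG Gw).
by rewrite leq_add ?(card_zeros_line_roots hG (pts_neq0 ap) va wa vw Gw)
  ?(card_tangency_double_roots hG (pts_neq0 ap) va wa vw Gw).
Qed.

Lemma tangency_leq G a : (#|tangency G a| <= #|line a :&: zeros G|)%N.
Proof. by apply: subset_leq_card; apply/subsetP => v; rewrite inE => /andP[]. Qed.

Definition grad G v : V := \row_i ev (mderiv i G) v.

Lemma ev_polar_grad G u v : ev (polar (u 0) G) v = ev (linform (grad G v)) u.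
Proof.
rewrite ev_linform /ev /polar (raddf_sum (meval _)); apply: eq_bigr => i _.
by rewrite /= mevalZ mulrC mxE.
Qed.

Lemma inc_normalize g u : inc (normalize g) u = inc g u.
Proof.
have [->|g0] := eqVneq g 0; first by rewrite /normalize scaler0.
by rewrite (incC (normalize g)) (incC g) incZE // invr_eq0 first_coord_eq0.
Qed.

(** The gradient is the equation of the tangent; where it is zero, any line
    through the point will do. *)
Lemma has_tangent d G v : form d G -> v \in zeros G ->
  exists2 a, a \in pts & v \in tangency G a.
Proof.
move=> hG vZ; have [vp /eqP Gv] : v \in pts /\ ev G v == 0 by move: vZ; rewrite inE => /andP.
have polE u := ev_polar_grad G u v; set g := grad G v in polE.
have [g0|g0] := eqVneq g 0.
  have [a av] : exists a, a \in line v.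
    by apply/card_gt0P; rewrite card_line // pts_neq0.
  exists a; first exact: line_pts av.
  rewrite in_tangency vZ in_line vp incC (line_inc av) /=.
  apply/forall_inP => u _; rewrite polE g0 ev_linform big1 // => i _.
  by rewrite mxE mul0r.
exists (normalize g); first exact: normalize_pts.
rewrite in_tangency vZ in_line vp inc_normalize inc_ev -polE (ev_polar_self _ hG) Gv mulr0 eqxx /=.
by apply/forall_inP => u /line_inc; rewrite inc_normalize inc_ev polE.
Qed.

Lemma sum_tangency d G : form d G -> (#|zeros G| <= \sum_(a in pts) #|tangency G a|)%N.
Proof.
move=> hG; apply: (@leq_trans (\sum_(a in pts) \sum_(v in zeros G) (v \in tangency G a))%N).
  rewrite exchange_big -sum1_card /=; apply: leq_sum => v /(has_tangent hG)[a ap va].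
  by rewrite (bigD1 a) //= va.
apply: leq_sum => a _; rewrite -sum1_card big_mkcond [X in (_ <= X)%N]big_mkcond /=.
apply: leq_sum => v _; rewrite in_tangency.
by case: (v \in zeros G); case: (v \in line a); case: (tangent G a v).
Qed.

Lemma in_tangents G v c :
  (c \in [set a in pts | v \in tangency G a]) = (c \in pts) && (v \in tangency G c).
Proof. by rewrite in_set. Qed.

Lemma sum_tangencyE G : (\sum_(a in pts) #|tangency G a| =
  \sum_(v in zeros G) #|[set a in pts | v \in tangency G a]|)%N.
Proof.
transitivity (\sum_(a in pts) \sum_(v in zeros G) (v \in tangency G a))%N.
  apply: eq_bigr => a _; rewrite -sum1_card big_mkcond [RHS]big_mkcond /=.
  apply: eq_bigr => v _; case: (boolP (v \in zeros G)) => vZ; first by case: (_ \in _).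
  by rewrite in_tangency (negPf vZ) andbF.
rewrite exchange_big; apply: eq_bigr => v _; rewrite -sum1_card big_mkcond [RHS]big_mkcond /=.
apply: eq_bigr => a _; rewrite in_tangents.
by case: (a \in pts); case: (v \in tangency G a).
Qed.

Definition lineless G := forall a, a \in pts -> ~~ (line a \subset zeros G).

(** Every point of the curve has a tangent line, on which there are fewer
    rational points than the degree allows; [deficit_bound] measures the loss. *)
Lemma lineless_bound d G : form d.+1 G -> lineless G -> (0 < #|zeros G|)%N ->
  (#|zeros G| + uphalf d.+1 + q <= d.+1 * q.+1)%N.
Proof.
move=> hG nl N0; apply: (@deficit_bound _ _ _ (fun a => #|tangency G a|)) => //.
- exact: zeros_sub.
- by move=> a _; apply: tangency_leq.
- by move=> a ap; apply: line_bound => //; apply: nl.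
- exact: sum_tangency hG.
Qed.

(** In the extremal case no point has two tangents; in particular the curve has
    no singular rational point. *)
Lemma lineless_extremal d G : form d.+1 G -> lineless G ->
    (#|zeros G| + uphalf d.+1 + q = d.+1 * q.+1)%N ->
  (forall a, a \in pts ->
    #|line a :&: zeros G| * (d.+1 - #|line a :&: zeros G|) = uphalf d.+1 * #|tangency G a|)%N /\
  (\sum_(a in pts) #|tangency G a| = #|zeros G|)%N /\
  (forall v a b, a \in pts -> b \in pts -> v \in tangency G a -> v \in tangency G b -> a = b).
Proof.
move=> hG nl E.
have [|||||A B] := @deficit_eq _ _ d.+1 (fun a => #|tangency G a|) _ _ _ _ E.
- exact: zeros_sub.
- by move=> a _; apply: tangency_leq.
- by move=> a ap; apply: line_bound => //; apply: nl.
- exact: sum_tangency hG.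
- by [].
split=> //; split=> // v a b ap bp va vb; apply/eqP; rewrite -[_ == _]negbK; apply/negP => ab.
have vZ : v \in zeros G by move: va; rewrite in_tangency => /and3P[].
have : (#|zeros G| < \sum_(v in zeros G) #|[set a in pts | v \in tangency G a]|)%N.
  rewrite (bigD1 v) //= -sum1_card (bigD1 v) //= -addSn.
  apply: leq_add.
    apply: (@leq_trans #|[set a; b]|); first by rewrite cards2 ab.
    apply: subset_leq_card; apply/subsetP => c; rewrite in_set2 in_tangents.
    by case/orP => /eqP ->; rewrite ?ap ?bp.
  apply: leq_sum => u /andP[/(has_tangent hG)[c cp uc] _].
  by apply/card_gt0P; exists c; rewrite in_tangents cp.
by rewrite -sum_tangencyE A ltnn.
Qed.

End Curves.

(** * Joins, meets and pencils *)

Section Plane2.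
Variable F : finFieldType.
Notation V := 'rV[F]_3.
Notation q := #|F|.
Notation pts := (pts F).
Implicit Types (G : {mpoly F[3]}) (u v w a b : V).

Lemma join_unique a b u v : a \in pts -> b \in pts -> u != v ->
  u \in line a -> v \in line a -> u \in line b -> v \in line b -> a = b.
Proof.
move=> ap bp uv ua va ub vb.
have /eqP/cards1P[c cE] := card_join (line_pts ua) (line_pts va) uv.
have A : a \in [set c] by rewrite -cE in_set ap !line_inc.
have B : b \in [set c] by rewrite -cE in_set bp !line_inc.
by move: A B; rewrite !in_set1 => /eqP -> /eqP ->.
Qed.

Lemma join_exists u v : u \in pts -> v \in pts -> u != v ->
  exists a, [/\ a \in pts, u \in line a & v \in line a].
Proof.
move=> up vp uv; have /eqP/cards1P[c cE] := card_join up vp uv.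
have : c \in [set c] by rewrite in_set1.
rewrite -cE in_set => /and3P[cp cu cv].
by exists c; rewrite !in_line up vp.
Qed.

Lemma meet_exists a b : a \in pts -> b \in pts -> a != b ->
  exists v, v \in line a /\ v \in line b.
Proof.
move=> ap bp ab; have [v [vp va vb]] := join_exists ap bp ab.
by exists v; rewrite !(line_sym _ vp).
Qed.

(** The lines through R partition the points other than R. *)
Lemma pencil_sum (S : {set V}) R : S \subset pts -> R \in pts -> R \notin S ->
  (\sum_(a in line R) #|line a :&: S| = #|S|)%N.
Proof.
move=> /subsetP sS Rp RS.
transitivity (\sum_(a in line R) \sum_(v in S) (v \in line a))%N.
  apply: eq_bigr => a _; rewrite -sum1_card big_mkcond [RHS]big_mkcond /=.
  by apply: eq_bigr => v _; rewrite in_setI; case: (v \in S); case: (v \in line a).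
rewrite exchange_big /= -sum1_card; apply: eq_bigr => v vS.
have vR : R != v by apply: contraNneq RS => ->.
have J := card_join Rp (sS v vS) vR.
apply: etrans J; rewrite -sum1_card big_mkcond [RHS]big_mkcond /=.
apply: eq_bigr => a _; rewrite [in RHS]in_set !in_line (sS v vS) /= incC.
by case: (a \in pts); case: (inc a R); case: (inc a v).
Qed.

Lemma avoid_line v R : v \in pts -> v != R ->
  exists a, [/\ a \in pts, v \in line a & R \notin line a].
Proof.
move=> vp vR.
have [|Rp] := boolP (R \in pts); last first.
  have [a av _] := other_on_line 0 vp; exists a; split.
  - exact: line_pts av.
  - by rewrite (line_sym (line_pts av) vp).
  - by apply: contra Rp => /line_pts.
move=> Rp; have [b [bp vb Rb]] := join_exists vp Rp vR.
have [a av ab] := other_on_line b vp.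
have ap := line_pts av; have va : v \in line a by rewrite line_sym.
exists a; split=> //.
apply: contra ab => Ra; apply/eqP; exact: (join_unique ap bp vR).
Qed.

Lemma off_line a : a \in pts -> exists2 u, u \in pts & u \notin line a.
Proof.
move=> ap; have [u ua _] := other_on_line 0 ap.
have [v va vu] := other_on_line u ap.
have uv : u != v by rewrite eq_sym.
have [b [bp ub vb]] := avoid_line (line_pts ua) uv.
have [w wb wu] := other_on_line u bp; exists w; first exact: line_pts wb.
apply: contra vb => wa; rewrite -(join_unique ap bp wu) //.
Qed.

(** The map x -> x^q is the identity of F; apply it to -1. *)
Lemma even_char2 : ~~ odd q -> 2%:R = 0 :> F.
Proof.
move=> qe; have := expf_card (-1 : F).
rewrite -signr_odd (negPf qe) expr0 => E.
by rewrite mulr2n {2}E subrr.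
Qed.

End Plane2.

(** * A quartic with 3q + 2 points meets every line *)

Section Quartic.
Variable F : finFieldType.
Notation V := 'rV[F]_3.
Notation q := #|F|.
Notation pts := (pts F).
Variable G : {mpoly F[3]}.
Hypothesis hG : G \is 4.-homog.
Hypothesis nl : lineless G.
Hypothesis q5 : (5 <= q)%N.
Hypothesis N : (#|zeros G| = 3 * q + 2)%N.
Variable b : V.
Hypothesis bp : b \in pts.
Hypothesis bZ : line b :&: zeros G = set0.

Let n a := #|line a :&: zeros G|.
Let t a := #|tangency G a|.

Let extremal : (forall a, a \in pts -> n a * (4 - n a) = 2 * t a)%N /\
  (\sum_(a in pts) t a = #|zeros G|)%N /\
  (forall v a c, a \in pts -> c \in pts -> v \in tangency G a -> v \in tangency G c -> a = c).
Proof.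
have E : (#|zeros G| + uphalf 4 + q = 4 * q.+1)%N by rewrite N /=; lia.
by have [A [bitangents C]] := lineless_extremal hG nl E; split; [exact: A|split].
Qed.

Let tangency_le_card a : (t a <= n a)%N. Proof. exact: tangency_leq. Qed.
Let card_tangency_le a : a \in pts -> (n a + t a <= 4)%N.
Proof. by move=> ap; apply: line_bound => //; apply: nl. Qed.

(** With n + t <= 4 and t <= n, the equality n (4 - n) = 2 t leaves only the
    values 0, 2, 4 for n, and t = 2 exactly when n = 2. *)
Let tangency_cards a : a \in pts -> t a = (if n a == 2 then 2 else 0)%N /\ ~~ odd (n a).
Proof.
move=> ap; have := card_tangency_le ap; have := tangency_le_card a; have := extremal.1 a ap.
by case: (n a) => [|[|[|[|[|m]]]]] /=; case: (t a) => [|[|[|k]]] //=; lia.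
Qed.

(** Counting the points along the lines through a point off the quartic shows
    that 3q + 2 is even. *)
Let char2 : 2%:R = 0 :> F.
Proof.
apply: even_char2; have [R Rb _] := other_on_line 0 bp.
have RZ : R \notin zeros G.
  by apply/negP => RZ; have := in_set0 R; rewrite -bZ in_setI Rb RZ.
have : ~~ odd #|zeros G|.
  rewrite -(pencil_sum (zeros_sub G) (line_pts Rb) RZ).
  apply: (big_ind (fun m => ~~ odd m)) => // [x y /negPf xe /negPf ye|a aR].
    by rewrite oddD xe ye.
  by have [] := tangency_cards (line_pts aR).
by rewrite N oddD oddM /= addbF.
Qed.

(** Along a bitangent the gradient is everywhere proportional to the equation
    of the bitangent, since the restriction of the quartic to it is a square and
    the characteristic is 2. *)
Let polar_bitangent a : a \in pts -> n a = 2 ->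
  forall u w, u \in line a -> w \in line a -> ev (polar (u 0) G) w = 0.
Proof.
move=> ap na u w ua wa.
have ta : t a = 2 by have [] := tangency_cards ap; rewrite na.
have ch4 : 4%:R = 0 :> F by rewrite (natrM F 2 2) char2 mul0r.
(* x is a point of the line off the quartic and different from w; the
   derivative at w vanishes in the direction x, and in the direction w by Euler *)
have [x xa] : exists x, x \in (line a :\: zeros G) :\ w.
  apply/card_gt0P; have := cardsD1 w (line a :\: zeros G).
  have := cardsID (zeros G) (line a); rewrite -/(n a) na (card_line (pts_neq0 ap)).
  have : ((w \in line a :\: zeros G) <= 1)%N by case: (_ \in _).
  by lia.
move: xa => /setD1P[xw /setDP[xa xZ]].
have Gx : ev G x != 0 by move: xZ; rewrite inE (line_pts xa).
have px : ev (polar (x 0) G) w = 0.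
  apply: (polar_eq0_all_double hG (pts_neq0 ap) wa xa _ Gx (k := 2)) => //.
  by rewrite eq_sym.
have [y [z ->]] := line_span (pts_neq0 ap) xa wa xw (line_inc ua).
by rewrite ev_polarD px mulr0 add0r (ev_polar_self _ hG) ch4 mul0r mulr0.
Qed.

Let bitangents : {set V} := [set a in pts | n a == 2].

Let card_bitangents : (#|bitangents| * 2 = 3 * q + 2)%N.
Proof.
rewrite -N -extremal.2.1 -sum_nat_const big_mkcond [RHS]big_mkcond /=.
apply: eq_bigr => a _; rewrite /bitangents in_set; case: (boolP (a \in pts)) => //= ap.
by have [-> _] := tangency_cards ap.
Qed.

Let bitangent_pts a : a \in bitangents -> a \in pts. Proof. by rewrite in_set => /andP[]. Qed.
Let bitangent_card a : a \in bitangents -> n a = 2. Proof. by rewrite in_set => /andP[_ /eqP]. Qed.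

(** The gradient there would be proportional to the equations of two
    distinct lines. *)
Let grad_meet a c v : a \in bitangents -> c \in bitangents -> a != c -> v \in line a -> v \in line c ->
  grad G v = 0.
Proof.
move=> aB cB ac va vc; apply/eqP; apply: contraT => g0.
have sub e : e \in bitangents -> v \in line e -> e = normalize (grad G v).
  move=> eB ve; have [x xe xv] := other_on_line v (bitangent_pts eB).
  have ix y : y \in line e -> y \in line (normalize (grad G v)).
    move=> ye; rewrite in_line (line_pts ye) inc_normalize inc_ev -ev_polar_grad.
    by rewrite (polar_bitangent (bitangent_pts eB) (bitangent_card eB) ye ve) eqxx.
  by apply: (join_unique (bitangent_pts eB) (normalize_pts g0) xv) => //; apply: ix.
by rewrite (sub a) // (sub c) // eqxx in ac.
Qed.

Let grad_smooth v : v \in zeros G -> grad G v != 0.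
Proof.
move=> vZ; have vp := subsetP (zeros_sub G) _ vZ.
have [a av _] := other_on_line 0 vp; have [c cv ca] := other_on_line a vp.
apply: contraNneq ca => g0; apply/eqP.
have tg e : e \in line v -> v \in tangency G e.
  move=> ev; rewrite in_tangency vZ (line_sym (line_pts ev) vp) ev /=.
  by apply/forall_inP => u _; rewrite ev_polar_grad g0 -inc_ev /inc trmx0 mulmx0.
by apply: (extremal.2.2 v) => //; rewrite ?tg ?(line_pts cv) ?(line_pts av).
Qed.

(** Fix a bitangent U and a point u0 outside it.  The derivative in the
    direction u0 is a cubic form which is not identically zero on U, because the
    quartic is smooth at its points on U, and which vanishes where U meets
    another bitangent.  So the 3q / 2 other bitangents meet U in at most three
    points, and one of these points is on at least three of them. *)
Let concurrent : exists2 R, R \in pts & (4 <= #|[set a in bitangents | R \in line a]|)%N /\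
  grad G R = 0.
Proof.
have [U UB] : exists U, U \in bitangents by apply/card_gt0P; lia.
have [u0 u0p u0U] := off_line (bitangent_pts UB).
pose k := polar (u0 0) G; have hk : k \is 3.-homog by apply: polar_homog.
have kU : ~~ (line U \subset zeros k).
  have [v] : exists v, v \in line U :&: zeros G.
    by apply/card_gt0P; rewrite -/(n U) (bitangent_card UB).
  move=> /setIP[vU vZ]; apply/subsetPn; exists v => //.
  apply/negP => /zeros_ev kv.
  have vu0 : v != u0 by apply: contraNneq u0U => <-.
  have [a [ap va ua]] := join_exists (line_pts vU) u0p vu0.
  have aU : a = U.
    apply: (extremal.2.2 v) => //; first exact: bitangent_pts; rewrite in_tangency vZ ?va ?vU /=.
      apply/forall_inP => w wa.
      have [x [y ->]] := line_span (pts_neq0 ap) va ua vu0 (line_inc wa).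
      by rewrite ev_polarD kv (ev_polar_self _ hG) (zeros_ev vZ) !mulr0 addr0.
    by apply/forall_inP => w wU; rewrite (polar_bitangent (bitangent_pts UB) (bitangent_card UB)).
  by rewrite -aU ua in u0U.
pose Zk := line U :&: zeros k.
have Zk3 : (#|Zk| <= 3)%N.
  by apply: leq_trans (line_bound hk (bitangent_pts UB) kU); rewrite leq_addr.
have cardBU : (#|bitangents :\ U| + 1 = #|bitangents|)%N by rewrite (cardsD1 U bitangents) UB addnC.
have meets : (#|bitangents :\ U| <= \sum_(R in Zk) #|[set a in bitangents :\ U | R \in line a]|)%N.
  apply: (@leq_trans (\sum_(R in Zk) \sum_(a in bitangents :\ U) (R \in line a))%N); last first.
    apply: leq_sum => R _; rewrite -sum1_card big_mkcond [X in (_ <= X)%N]big_mkcond /=.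
    apply: leq_sum => a _; rewrite [X in (_ <= (if X then _ else _))%N]in_set.
    by case: (a \in bitangents :\ U); case: (R \in line a).
  rewrite exchange_big -sum1_card /=; apply: leq_sum => a /setD1P[aU aB].
  have [R [Ra RU]] := meet_exists (bitangent_pts aB) (bitangent_pts UB) aU.
  have RZ : R \in Zk.
    rewrite in_setI RU inE (line_pts RU) ev_polar_grad.
    by rewrite (grad_meet aB UB aU Ra RU) -inc_ev /inc trmx0 mulmx0 /=.
  by rewrite (bigD1 R) //= Ra.
have [R RZ R3] : exists2 R, R \in Zk & (3 <= #|[set a in bitangents :\ U | R \in line a]|)%N.
  apply/exists_inP; apply: contraT; rewrite negb_exists_in => /forall_inP le2.
  have : (\sum_(R in Zk) #|[set a in bitangents :\ U | R \in line a]| <= \sum_(R in Zk) 2)%N.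
    by apply: leq_sum => R /le2; rewrite -ltnNge.
  rewrite sum_nat_const; move: meets; move: (\sum_(R in Zk) _)%N => T.
  move: cardBU card_bitangents Zk3 q5; clear.
  by move: #|bitangents :\ U| #|bitangents| #|Zk| q => x y z t; lia.
have RU : R \in line U by move: RZ; rewrite in_setI => /andP[].
have sub3 : [set a in bitangents :\ U | R \in line a] \subset [set a in bitangents | R \in line a] :\ U.
  by apply/subsetP => a; rewrite !in_set => /andP[/andP[-> ->] ->].
exists R; first exact: line_pts RU; split.
  rewrite (cardsD1 U) in_set UB RU /= add1n ltnS.
  exact: leq_trans R3 (subset_leq_card sub3).
have [a aR] : exists a, a \in [set a in bitangents :\ U | R \in line a].
  by apply/card_gt0P; apply: leq_trans R3.
move: aR; rewrite in_set => /andP[/setD1P[aU aB] Ra].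
exact: grad_meet aB UB aU Ra RU.
Qed.

(** Let R be on four bitangents.  The derivative k in the direction R is a
    cubic form vanishing on these four lines.  A line not through R meets them
    in four points, more than the degree of k, so k vanishes on it.  Hence k
    vanishes at all the points of the quartic, and all tangents pass through R.
    A line through R then has at most two points of the quartic. *)
Lemma no_maximal_quartic_off_line : False.
Proof.
have [R Rp [B4 gR]] := concurrent.
pose k := polar (R 0) G; have hk : k \is 3.-homog by apply: polar_homog.
have BRk a : a \in bitangents -> R \in line a -> line a \subset zeros k.
  move=> aB Ra; apply/subsetP => v va.
  by rewrite inE (line_pts va) (polar_bitangent (bitangent_pts aB) (bitangent_card aB)) ?eqxx.
have RnZ : R \notin zeros G by apply/negP => /grad_smooth; rewrite gR eqxx.
have kZ v : v \in zeros G -> ev k v = 0.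
  move=> vZ; have vp := subsetP (zeros_sub G) _ vZ.
  have vR : v != R by apply: contraNneq RnZ => <-.
  have [m [mp vm Rm]] := avoid_line vp vR.
  suff /subsetP/(_ v vm)/zeros_ev : line m \subset zeros k by [].
  apply: contraT => /(line_bound hk mp) => n3.
  have := leq_trans (leq_addr _ _) n3; rewrite leqNgt => /negP[].
  apply: leq_trans B4 _.
  (* m differs from the lines a through R, so it meets them and 0 is only a filler *)
  pose P a := odflt 0 [pick x in line m :&: line a].
  have PE a : a \in bitangents -> R \in line a -> P a \in line m /\ P a \in line a.
    move=> aB Ra; rewrite /P; case: pickP => [x /setIP[]//|no].
    have ma : m != a by apply: contraNneq Rm => ->.
    have [x [xm xa]] := meet_exists mp (bitangent_pts aB) ma.
    by have := no x; rewrite in_setI xm xa.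
  rewrite -(card_in_imset (f := P)).
    apply: subset_leq_card; apply/subsetP => _ /imsetP[a + ->].
    rewrite in_set => /andP[aB Ra]; have [Pm Pa] := PE a aB Ra.
    by rewrite in_setI Pm (subsetP (BRk a aB Ra)).
  move=> a c /setIdP[aB Ra] /setIdP[cB Rc] E.
  have [Pm Pa] := PE a aB Ra; have [_ Pc] := PE c cB Rc; rewrite -E in Pc.
  have RP : R != P a by apply: contraNneq Rm => ->.
  exact: (join_unique (bitangent_pts aB) (bitangent_pts cB) RP).
have n2 a : a \in line R -> (n a <= 2)%N.
  move=> aR; have ap := line_pts aR.
  have [|n0] := posnP (n a); first by move=> ->.
  have [v /setIP[va vZ]] := card_gt0P n0.
  have vR : R != v by apply: contraNneq RnZ => ->.
  have : (0 < t a)%N.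
    apply/card_gt0P; exists v; rewrite in_tangency va vZ /=.
    apply/forall_inP => u ua.
    have Ra : R \in line a by rewrite (line_sym ap Rp).
    have [x [y ->]] := line_span (pts_neq0 ap) Ra va vR (line_inc ua).
    by rewrite ev_polarD kZ // (ev_polar_self _ hG) (zeros_ev vZ) !mulr0 addr0.
  by have [-> _] := tangency_cards ap; case: eqP => // ->.
have := pencil_sum (zeros_sub G) Rp RnZ; rewrite N => E.
have : (\sum_(a in line R) n a <= \sum_(a in line R) 2)%N by apply: leq_sum.
by rewrite E sum_nat_const (card_line (pts_neq0 Rp)); lia.
Qed.

End Quartic.

(** * Zeros of quintics through the closed point *)

Section Upper.
Variables (F : finFieldType) (L : fieldExtType F) (p : 'I_3 -> L).
Hypothesis hline : ~ on_rational_line p.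
Notation V := 'rV[F]_3.
Notation q := #|F|.
Notation pts := (pts F).
Notation form d G := (is_true (G \is d.-homog)).
Implicit Types (G H : {mpoly F[3]}) (u v w a b : V).

Lemma zerosM G H : zeros (G * H) = zeros G :|: zeros H.
Proof. by apply/setP => v; rewrite in_setU ![_ \in zeros _]inE evM mulf_eq0 -andb_orr. Qed.

Lemma vanishesM G H : vanishes_at p (G * H) -> vanishes_at p G \/ vanishes_at p H.
Proof.
rewrite /vanishes_at rmorphM mevalM => /eqP; rewrite mulf_eq0.
by case/orP => /eqP; [left|right].
Qed.

(** This is the hypothesis that p is on no rational line. *)
Lemma vanishes_linform a : vanishes_at p (linform a) -> a = 0.
Proof.
rewrite /vanishes_at /linform (raddf_sum (map_mpoly (in_alg L))) (raddf_sum (meval p)) /= => E.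
apply/eqP; apply: contraT => a0; case: hline; exists (a 0); split; first exact/rV0Pn.
rewrite -[RHS]E; apply: eq_bigr => i _.
by rewrite map_mpolyZ mevalZ map_mpolyX mevalXU /= mulr_algl.
Qed.

Lemma form1_linform H : form 1 H -> exists a, H = linform a.
Proof.
move=> /dhomogP h1; exists (\row_i H@_U_(i)); apply/mpolyP => m.
rewrite /linform raddf_sum /=.
have [mH|mH] := boolP (mdeg m == 1%N).
  move: mH; rewrite mdeg_eq1 => /existsP[i /eqP ->].
  rewrite (bigD1 i) //= mcoeffZ mcoeffXU eqxx mulr1 mxE big1 ?addr0 // => j ji.
  by rewrite mcoeffZ mcoeffXU (negPf ji) mulr0.
rewrite big1 => [|i _].
  by apply: memN_msupp_eq0; apply: contra mH => /h1 ->.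
rewrite mcoeffZ mcoeffX; case: eqP => [E|]; rewrite ?mulr0 //.
by move: mH; rewrite -E mdeg1.
Qed.

(** A line contained in the curve can be split off, and the remaining factor
    still vanishes at p since the equation of the line does not. *)
Lemma lineless_or_split d G : form d.+1 G -> (d < q)%N -> G != 0 -> vanishes_at p G ->
  lineless G \/ exists a H, [/\ a \in pts, form d H, H != 0, vanishes_at p H
                              & zeros G = line a :|: zeros H].
Proof.
move=> hG dq G0 vG.
have [/exists_inP[a ap sa]|no] := boolP [exists a in pts, line a \subset zeros G].
  right; have [H hH GE] := line_factor hG dq (pts_neq0 ap) sa.
  exists a, H; split; [exact: ap|exact: hH| | |].
  - by apply: contraNneq G0 => H0; rewrite GE H0 mulr0.
  - rewrite GE in vG; case: (vanishesM vG) => [/vanishes_linform a0|vH]; last exact: vH.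
    by case/eqP: (pts_neq0 ap).
  - by rewrite GE zerosM line_zeros.
by left => a ap; move: no; rewrite negb_exists_in => /forall_inP/(_ a ap).
Qed.

(** Splitting off a line would leave a linear form vanishing at p. *)
Lemma conic_lineless G : form 2 G -> (1 < q)%N -> G != 0 -> vanishes_at p G -> lineless G.
Proof.
move=> hG q1 G0 /(lineless_or_split hG q1 G0)[//|[a [H [ap /form1_linform[b ->] H0]]]].
move=> /vanishes_linform b0; move: H0; rewrite b0 /linform big1 ?eqxx // => i _.
by rewrite mxE scale0r.
Qed.

Lemma card_meet a b : a \in pts -> b \in pts -> (0 < #|line a :&: line b|)%N.
Proof.
move=> ap bp; have [->|ab] := eqVneq a b.
  by rewrite setIid card_line // pts_neq0.
have [v [va vb]] := meet_exists ap bp ab.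
by apply/card_gt0P; exists v; rewrite in_setI va.
Qed.

Lemma lineless_leq d G : form d.+1 G -> lineless G ->
  (#|zeros G| <= d.+1 * q.+1 - uphalf d.+1 - q)%N.
Proof.
move=> hG nl; have [->//|N0] := posnP #|zeros G|.
by have := lineless_bound hG nl N0; lia.
Qed.

(** Split off rational lines as long as there are some.  If e lines come off,
    then 4q + 2 results from the bounds for degree 5 - e when e = 0, 2, 3, using
    that two lines always meet; for e = 1 the sum of the bounds is 4q + 3, and
    is not reached. *)
Lemma quintic_bound G : (5 <= q)%N -> form 5 G -> G != 0 -> vanishes_at p G ->
  (#|zeros G| <= 4 * q + 2)%N.
Proof.
move=> q5 hG G0 vG.
have U (A B : {set V}) : (#|A :|: B| + #|A :&: B| = #|A| + #|B|)%N by rewrite cardsUI.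
have cl a : a \in pts -> #|line a| = q.+1 by move=> ap; rewrite card_line // pts_neq0.
have [nl|[a1 [G1 [a1p hG1 G10 vG1 ->]]]] := lineless_or_split hG q5 G0 vG.
  by have := lineless_leq hG nl; rewrite /=; lia.
have [nl|[a2 [G2 [a2p hG2 G20 vG2 ->]]]] := lineless_or_split hG1 (ltnW q5) G10 vG1.
  have le := lineless_leq hG1 nl; have := U (line a1) (zeros G1); rewrite cl //.
  have [E|nE] := eqVneq #|zeros G1| (3 * q + 2)%N; last first.
    rewrite /= in le *; move: le nE q5; clear.
    by move: #|_ :|: _| #|_ :&: _| #|zeros G1| q => x y z t; lia.
  have [I0|] := eqVneq (line a1 :&: zeros G1) set0.
    by have := no_maximal_quartic_off_line hG1 nl q5 E a1p I0.
  rewrite -card_gt0 E; clear; move: #|_ :|: _| #|_ :&: _| q => x y t; lia.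
have [nl|[a3 [G3 [a3p hG3 G30 vG3 ->]]]] := lineless_or_split hG2 (ltnW (ltnW q5)) G20 vG2.
  have le := lineless_leq hG2 nl.
  have := U (line a1) (line a2 :|: zeros G2); have := U (line a2) (zeros G2).
  have : (0 < #|line a1 :&: (line a2 :|: zeros G2)|)%N.
    apply: leq_trans (card_meet a1p a2p) (subset_leq_card _).
    by rewrite setIUr subsetUl.
  rewrite !cl //; move: le; rewrite /=; clear.
  move: #|line a1 :|: (_ :|: _)| #|line a1 :&: _| #|line a2 :&: _| #|line a2 :|: _|.
  by move: #|zeros G2| q => *; lia.
have nl := conic_lineless hG3 (ltn_trans (isT : 1 < 4)%N q5) G30 vG3.
have le := lineless_leq hG3 nl.
have := U (line a1) (line a2 :|: (line a3 :|: zeros G3)).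
have := U (line a2) (line a3 :|: zeros G3); have := U (line a3) (zeros G3).
have : (0 < #|line a1 :&: (line a2 :|: (line a3 :|: zeros G3))|)%N.
  apply: leq_trans (card_meet a1p a2p) (subset_leq_card _).
  by rewrite setIUr subsetUl.
have : (0 < #|line a2 :&: (line a3 :|: zeros G3)|)%N.
  apply: leq_trans (card_meet a2p a3p) (subset_leq_card _).
  by rewrite setIUr subsetUl.
rewrite !cl //; move: le; rewrite /=; clear.
move: #|line a1 :|: (_ :|: _)| #|line a1 :&: _| #|line a2 :&: _| #|line a2 :|: _|.
by move: #|line a3 :&: _| #|line a3 :|: _| #|zeros G3| q => *; lia.
Qed.

End Upper.

(** * Evaluation of forms as linear maps *)

Section EvalMaps.
Variables (F : finFieldType) (L : fieldExtType F) (p : 'I_3 -> L) (d : nat).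

Definition value_at (G : dhomog 3 F d) : L := (map_mpoly (in_alg L) (val G)).@[p].

Fact value_at_is_linear : linear value_at.
Proof.
move=> c G H; rewrite /value_at linearP /= rmorphD /= map_mpolyZ mevalD mevalZ /=.
by rewrite mulr_algl.
Qed.

HB.instance Definition _ :=
  GRing.isLinear.Build F (dhomog 3 F d) L _ value_at value_at_is_linear.

Variables (n : nat) (c : 'I_n -> F) (v : 'I_n -> 'rV[F]_3).

(** The weights account for the choice of coordinates on the fibres of the line
    bundle. *)
Definition weighted_values (G : dhomog 3 F d) : 'rV[F]_n := \row_i (c i * ev (val G) (v i)).

Fact weighted_values_is_linear : linear weighted_values.
Proof.
move=> x G H; apply/rowP => i; rewrite !mxE.
have -> : val (x *: G + H) = x *: val G + val H by [].
by rewrite /ev mevalD mevalZ mulrDr mulrCA.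
Qed.

HB.instance Definition _ :=
  GRing.isLinear.Build F (dhomog 3 F d) 'rV[F]_n _ weighted_values weighted_values_is_linear.

End EvalMaps.

(** * Dimension of the space of forms vanishing at the closed point *)

Section Dimensions.
Variables (F : finFieldType) (L : fieldExtType F) (p : 'I_3 -> L).
Hypothesis hdeg : closed_point_degree p = 3%N.
Hypothesis hline : ~ on_rational_line p.
Notation form d G := (is_true (G \is d.-homog)).

Lemma free_coords : free [tuple p i | i < 3].
Proof.
apply/freeP => k; under eq_bigr => i _ do rewrite nth_mktuple.
move=> E i; apply/eqP; apply: contraT => ki; case: hline.
by exists k; split; first by exists i.
Qed.

Lemma coord_neq0 i : p i != 0.
Proof.
apply: contra_not_neq hline => pi; exists (fun j => (j == i)%:R); split.
  by exists i; rewrite eqxx oner_eq0.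
by rewrite (bigD1 i) //= pi scaler0 add0r big1 // => j /negPf ->; rewrite scale0r.
Qed.

Let k := <<1 & [seq p i / p j | i <- enum 'I_3, j <- enum 'I_3]>>%AS.

(** Divided by the d-th power of p 0, the values lie in the residue field of p,
    of degree 3; and the products of p 0, p 1, p 2 with the power d - 1 of p 0
    are already independent over F. *)
Lemma dim_values_at d : (0 < d)%N ->
  \dim (limg (linfun (@value_at F L p d))) = 3%N.
Proof.
move=> d0; apply/eqP; rewrite eqn_leq; apply/andP; split.
  have <- : \dim (amulr (p 0 ^+ d) @: k) = 3%N.
    rewrite -hdeg limg_dim_eq //.
    have /eqP -> : lker (amulr (p 0 ^+ d)) == 0%VS.
      by apply: lker0_amulr; rewrite unitfE expf_neq0 // coord_neq0.
    by rewrite capv0.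
  apply: dimvS; apply/subvP => _ /memv_imgP[G _ ->]; rewrite lfunE /=.
  have /dhomogP hG : val G \is d.-homog by case: G.
  rewrite /value_at {1}[val G]mpolyE (raddf_sum (map_mpoly (in_alg L))) (raddf_sum (meval p)) /=.
  rewrite big_seq; apply: rpred_sum => m mG.
  rewrite map_mpolyZ mevalZ /= mulr_algl rpredZ // map_mpolyX mevalX.
  have hm : mdeg m = d by exact: hG.
  have -> : \prod_(i < 3) p i ^+ m i = amulr (p 0 ^+ d) (\prod_(i < 3) (p i / p 0) ^+ m i).
    rewrite lfunE /= -hm mdegE -prodrXr -big_split /=; apply: eq_bigr => i _.
    by rewrite exprMn exprVn divfK // expf_neq0 // coord_neq0.
  apply: memv_img; apply: rpred_prod => i _; apply: rpredX.
  apply: seqv_sub_adjoin; apply/allpairsP; exists (i, 0) => /=.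
  by rewrite !mem_enum.
have <- : \dim (amulr (p 0 ^+ d.-1) @: <<[tuple p i | i < 3]>>) = 3%N.
  rewrite limg_dim_eq; first by rewrite (eqP free_coords) size_tuple.
  have /eqP -> : lker (amulr (p 0 ^+ d.-1)) == 0%VS.
    by apply: lker0_amulr; rewrite unitfE expf_neq0 // coord_neq0.
  by rewrite capv0.
apply: dimvS; rewrite limg_span; apply/span_subvP => _ /mapP[_ /tnthP[i ->] ->].
rewrite tnth_mktuple lfunE /=.
have hH : ('X_i * 'X_0 ^+ d.-1 : {mpoly F[3]}) \is d.-homog.
  have h1 j : ('X_j : {mpoly F[3]}) \is 1.-homog by rewrite dhomogX /= mdeg1.
  have := dhomogM (h1 i) (dhomogMn d.-1 (h1 0)).
  by rewrite mul1n add1n prednK.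
have -> : p i * p 0 ^+ d.-1 = linfun (@value_at F L p d) (DHomog hH).
  rewrite lfunE /= /value_at /= rmorphM rmorphXn /= !map_mpolyX mevalM.
  by rewrite rmorphXn /= !mevalXU.
by rewrite memv_img ?memvf.
Qed.

Lemma dim_forms_vanishing d : (0 < d)%N ->
  (\dim (lker (linfun (@value_at F L p d))) + 3 = 'C(d + 2, d))%N.
Proof.
move=> d0; have := limg_ker_dim (linfun (@value_at F L p d)) fullv.
by rewrite capfv dim_values_at // dimvf.
Qed.

Lemma mem_ker_value_at d (G : dhomog 3 F d) :
  (G \in lker (linfun (@value_at F L p d))) = (value_at p G == 0).
Proof. by rewrite memv_ker lfunE. Qed.

(** The space of quadratic forms has dimension 6; vanishing at p costs 3
    conditions, and each rational point one. *)
Lemma conic_through (v1 v2 : 'rV[F]_3) : exists Q : {mpoly F[3]},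
  [/\ form 2 Q, Q != 0, vanishes_at p Q, ev Q v1 = 0 & ev Q v2 = 0].
Proof.
pose v (i : 'I_2) := if i == 0 then v1 else v2.
have := limg_ker_dim (linfun (weighted_values (fun=> 1) v : dhomog 3 F 2 -> _))
  (lker (linfun (@value_at F L p 2))).
have := dim_forms_vanishing (isT : 0 < 2)%N; set K := lker _; set f := linfun _.
have : (\dim (f @: K) <= 2)%N.
  by apply: leq_trans (dimvS (subvf _)) _; rewrite dimvf /dim /= mul1n.
rewrite (_ : 'C(2 + 2, 2) = 6%N) // => le2 K3 E.
have : (K :&: lker f)%VS != 0%VS by rewrite -dimv_eq0; lia.
move=> /eqP; case: (eqVneq (vpick (K :&: lker f)) 0) => [/eqP|].
  by rewrite vpick0 => /eqP.
have := memv_pick (K :&: lker f); move: (vpick _) => Q.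
rewrite memv_cap mem_ker_value_at memv_ker => /andP[/eqP Qp] + Q0 _.
rewrite lfunE /= => /eqP/rowP Qv.
have Q0' : val Q != 0 by apply: contraNneq Q0 => Q0; apply/eqP/val_inj.
exists (val Q); split; [by case: (Q)|exact: Q0'|exact: Qp| |].
- by have := Qv 0; rewrite !mxE /v eqxx mul1r.
- by have := Qv 1; rewrite !mxE /v mul1r.
Qed.

End Dimensions.

(** * Points and external lines of a conic *)

Section Conic.
Variable F : finFieldType.
Notation V := 'rV[F]_3.
Notation q := #|F|.
Notation pts := (pts F).
Notation form d G := (is_true (G \is d.-homog)).
Variable Q : {mpoly F[3]}.
Hypothesis hQ : form 2 Q.
Hypothesis nl : lineless Q.
Variables v1 v2 : V.
Hypotheses (v12 : v1 != v2) (v1Z : v1 \in zeros Q) (v2Z : v2 \in zeros Q).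

Let v1p : v1 \in pts := subsetP (zeros_sub Q) _ v1Z.
Let v2p : v2 \in pts := subsetP (zeros_sub Q) _ v2Z.

Lemma ev_quadric u w t :
  ev Q (u + t *: w) = ev Q u + t * ev (polar (w 0) Q) u + t ^+ 2 * ev Q w.
Proof.
have [sz f2] := line_poly_homog idfun (u 0) (w 0) hQ.
have f0 : (line_poly idfun (u 0) (w 0) Q)`_0 = ev Q u.
  by rewrite -horner_coef0 horner_line scale0r addr0.
have f1 : (line_poly idfun (u 0) (w 0) Q)`_1 = ev (polar (w 0) Q) u.
  have := coef_deriv (line_poly idfun (u 0) (w 0) Q) 0.
  by rewrite deriv_line_poly mulr1n => <-; rewrite -horner_coef0 horner_line scale0r addr0.
rewrite -horner_line (horner_coef_wide _ sz) !big_ord_recl big_ord0 /=.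
by rewrite f0 f1 f2 mmap_idfun /bump /= /ev expr0 mulr1 expr1 addr0 addrA mulrC (mulrC (t ^+ 2)).
Qed.

(** Otherwise the conic would contain the line through v1 and v2. *)
Let smooth : ev (polar (v2 0) Q) v1 != 0.
Proof.
have [a [ap v1a v2a]] := join_exists v1p v2p v12.
apply: contraNneq (nl ap) => D0; apply/subsetP => u ua.
rewrite inE (line_pts ua) /=.
have [x [y ->]] := line_span (pts_neq0 ap) v1a v2a v12 (line_inc ua).
have [x0|x0] := eqVneq x 0.
  by rewrite x0 scale0r add0r (evZ _ _ hQ) (zeros_ev v2Z) mulr0.
rewrite -[y](mulfVK x0) mulrC -scalerA -scalerDr (evZ _ _ hQ) mulrC.
by rewrite ev_quadric D0 (zeros_ev v1Z) (zeros_ev v2Z) !mulr0 !addr0 mul0r.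
Qed.

(** On a line through v1 the quadratic form has one root at v1, so the second
    root is rational too; it is different from v1 when the line is not tangent. *)
Let second_point a : a \in line v1 -> v1 \notin tangency Q a ->
  (0 < #|line a :&: (zeros Q :\ v1)|)%N.
Proof.
move=> av1 nt; have ap := line_pts av1; have v1a : v1 \in line a by rewrite (line_sym ap v1p).
have [w wa wv1] := other_on_line v1 ap.
have v1w : v1 != w by rewrite eq_sym.
have [Qw|Qw] := eqVneq (ev Q w) 0.
  apply/card_gt0P; exists w; rewrite in_setI wa in_setD1 wv1 /=.
  by rewrite inE (line_pts wa) Qw eqxx.
have Dw : ev (polar (w 0) Q) v1 != 0.
  apply: contra nt => /eqP Dw; rewrite in_tangency v1a v1Z /=; apply/forall_inP => u ua.
  have [x [y ->]] := line_span (pts_neq0 ap) v1a wa v1w (line_inc ua).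
  by rewrite ev_polarD Dw (ev_polar_self _ hQ) (zeros_ev v1Z) !mulr0 addr0.
(* the nonzero root of t D_w Q(v1) + t^2 Q(w) *)
pose t := - (ev (polar (w 0) Q) v1 / ev Q w).
have t0 : t != 0 by rewrite oppr_eq0 mulf_neq0 // invr_eq0.
pose u := v1 + t *: w.
have Qu : ev Q u = 0.
  by rewrite ev_quadric (zeros_ev v1Z) /t; field.
have iu : inc a u by rewrite incD ?incZ ?line_inc.
have u0 : u != 0.
  apply: contraNneq v1w => u0; apply/eqP; apply: (@pts_scale _ _ _ (- t)) => //.
    exact: line_pts wa.
  by apply/eqP; rewrite scaleNr -subr_eq0 opprK -/u u0.
apply/card_gt0P; exists (normalize u); rewrite in_setI in_line normalize_pts //=.
rewrite /normalize incZE ?invr_eq0 ?first_coord_eq0 // iu in_setD1 /=.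
rewrite [_ \in zeros _]inE -/(normalize u) normalize_pts //=.
rewrite /normalize (evZ _ _ hQ) Qu mulr0 eqxx andbT.
apply: contraNneq v1w => E; apply/eqP/esym.
have uE : u = first_coord u *: v1 by rewrite -E scalerA mulfV ?scale1r // first_coord_eq0.
apply: (@pts_scale _ _ _ (t^-1 * (first_coord u - 1))) => //; first exact: line_pts wa.
by rewrite -scalerA scalerBl scale1r -uE /u addrC addKr scalerA mulVf // scale1r.
Qed.

(** Project from v1: each of the q + 1 lines through it, except its one tangent,
    carries exactly one further point. *)
Lemma conic_card : #|zeros Q| = q.+1.
Proof.
have le := lineless_leq hQ nl.
have S1 : zeros Q :\ v1 \subset pts by apply: subset_trans (subsetDl _ _) (zeros_sub Q).
have v1S : v1 \notin zeros Q :\ v1 by rewrite in_setD1 eqxx.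
have E := pencil_sum S1 v1p v1S.
have C : #|zeros Q| = #|zeros Q :\ v1|.+1 by rewrite (cardsD1 v1) v1Z.
pose T := [set a in line v1 | v1 \in tangency Q a].
have T1 : (#|T| <= 1)%N.
  rewrite leqNgt; apply/negP => /card_gt1P[a [b [/setIdP[av va] /setIdP[bv vb] ab]]].
  have g0 : grad Q v1 != 0.
    by apply: contraNneq smooth => g0; rewrite ev_polar_grad g0 -inc_ev /inc trmx0 mulmx0.
  have U c : c \in line v1 -> v1 \in tangency Q c -> c = normalize (grad Q v1).
    move=> cv vc; have cp := line_pts cv.
    have v1c : v1 \in line c by rewrite (line_sym cp v1p).
    have [w wc wv] := other_on_line v1 cp.
    move: vc; rewrite in_tangency => /and3P[_ _ /forall_inP tc].
    apply: (join_unique cp (normalize_pts g0) wv) => //.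
      by rewrite in_line (line_pts wc) inc_normalize inc_ev -ev_polar_grad tc.
    by rewrite in_line v1p inc_normalize inc_ev -ev_polar_grad tc.
  by rewrite (U a) // (U b) // eqxx in ab.
have : (\sum_(a in line v1) (v1 \notin tangency Q a) <=
    \sum_(a in line v1) #|line a :&: (zeros Q :\ v1)|)%N.
  by apply: leq_sum => a av; case: (boolP (v1 \in tangency Q a)) => // nt; apply: second_point.
have : (\sum_(a in line v1) (v1 \notin tangency Q a) +
    #|T| = q.+1)%N.
  rewrite -(card_line (pts_neq0 v1p)) -[RHS]sum1_card.
  have -> : #|T| = (\sum_(a in line v1) (v1 \in tangency Q a))%N.
    rewrite -sum1_card big_mkcond [RHS]big_mkcond; apply: eq_bigr => a _.
    by rewrite [in LHS]in_set; case: (a \in line v1); case: (v1 \in tangency Q a).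
  by rewrite -big_split; apply: eq_bigr => a _; case: (v1 \in tangency Q a).
move: T1 le; rewrite E C /=; clear; move: #|T| (\sum_(_ in _) _)%N #|_ :\ v1| q => *; lia.
Qed.

(** The q + 1 points have one tangent each and no line has three of them, so
    q (q - 1) / 2 lines are external.  They carry q (q - 1) (q + 1) / 2
    incidences with the q^2 points off the conic, on average more than 2. *)
Lemma external_lines : (5 <= q)%N ->
  exists2 R, R \in pts & (3 <= #|[set a in line R | line a :&: zeros Q == set0]|)%N.
Proof.
move=> q5; pose n a := #|line a :&: zeros Q|.
have X : (#|zeros Q| + uphalf 2 + q = 2 * q.+1)%N by rewrite conic_card /=; lia.
have [A [B _]] := lineless_extremal hQ nl X; rewrite conic_card in B.
have n2 a : a \in pts -> (n a <= 2)%N.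
  by move=> ap; apply: leq_trans (line_bound hQ ap (nl ap)); rewrite leq_addr.
pose E := [set a in pts | line a :&: zeros Q == set0].
have cE : (#|E| * 2 = q * q.-1)%N.
  have S1 := sum_line (zeros_sub Q); rewrite conic_card in S1.
  have P : (\sum_(a in pts) 2 = \sum_(a in pts)
      (#|line a :&: zeros Q| + #|tangency Q a| + 2 * (a \in E)))%N.
    apply: eq_bigr => a ap; have := A a ap; have := n2 a ap.
    have -> : (a \in E) = (n a == 0)%N by rewrite in_set ap cards_eq0.
    by rewrite -/(n a); clear; case: (n a) => [|[|[|m]]] //=; move: #|tangency Q a| => *; lia.
  have sumE : (\sum_(a in pts) 2 * (a \in E) = 2 * #|E|)%N.
    rewrite -sum1_card big_distrr big_mkcond [RHS]big_mkcond /=; apply: eq_bigr => a _.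
    have -> : (a \in E) = (a \in pts) && (line a :&: zeros Q == set0) by rewrite in_set.
    by case: (a \in pts); case: (_ == set0).
  move: P; rewrite 2!big_split /= sumE B S1 sum_nat_const (card_pts F).
  rewrite -mulnn; move: q5; clear; move: #|E|; case: q => // r e _ /=; nia.
have sE : E \subset pts by apply/subsetP => a /setIdP[].
have := sum_line sE; rewrite (bigID (mem (zeros Q))) /= big1; last first.
  move=> v /andP[vp vZ]; apply/eqP; rewrite cards_eq0; apply/eqP/setP => a.
  rewrite in_set0 in_setI; apply/negP => /andP[av /setIdP[ap /eqP a0]].
  by have := in_set0 v; rewrite -a0 in_setI vZ (line_sym ap vp) av.
rewrite add0n => S.
have [R /andP[Rp RZ] R3] : exists2 R, (R \in pts) && (R \notin zeros Q) &
    (3 <= #|line R :&: E|)%N.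
  apply/exists_inP; apply: contraT; rewrite negb_exists_in => /forall_inP le2.
  have : (\sum_(v in pts | v \notin zeros Q) #|line v :&: E| <=
      \sum_(v in pts | v \notin zeros Q) 2)%N.
    by apply: leq_sum => R /le2; rewrite -ltnNge.
  rewrite S sum_nat_const.
  have -> : #|[pred v in pts | v \notin zeros Q]| = #|pts :\: zeros Q|.
    by apply: eq_card => v; rewrite !in_setD inE /= andbC.
  have := cardsID (zeros Q) pts; rewrite (setIidPr (zeros_sub Q)) conic_card (card_pts F).
  rewrite -mulnn; move: cE q5; clear; move: #|E| #|_ :\: _|; case: q => // r e m /=; nia.
exists R => //; apply: leq_trans R3 (subset_leq_card _).
by apply/subsetP => a /setIP[aR /setIdP[_ a0]]; apply/setIdP.
Qed.

End Conic.

(** * A quintic with 4q + 2 zeros *)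

Section Extremal.
Variables (F : finFieldType) (L : fieldExtType F) (p : 'I_3 -> L).
Hypothesis hdeg : closed_point_degree p = 3%N.
Hypothesis hline : ~ on_rational_line p.
Notation V := 'rV[F]_3.
Notation q := #|F|.
Notation pts := (pts F).
Notation form d G := (is_true (G \is d.-homog)).

Lemma vanishesMl (G H : {mpoly F[3]}) : vanishes_at p H -> vanishes_at p (G * H).
Proof. by move=> vH; rewrite /vanishes_at rmorphM mevalM [X in _ * X]vH mulr0. Qed.

Lemma card_meet_le1 (a b : V) : a \in pts -> b \in pts -> a != b ->
  (#|line a :&: line b| <= 1)%N.
Proof.
move=> ap bp ab; rewrite leqNgt; apply/negP.
move=> /card_gt1P[u [v [/setIP[ua ub] /setIP[va vb] uv]]].
by rewrite (join_unique ap bp uv ua va ub vb) eqxx in ab.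
Qed.

(** Three concurrent lines have 3q + 1 points, and the conic q + 1 others. *)
Lemma extremal_quintic : (5 <= q)%N -> exists G : {mpoly F[3]},
  [/\ form 5 G, G != 0, vanishes_at p G & #|zeros G| = (4 * q + 2)%N].
Proof.
move=> q5; have [v1 [v2 [v1p v2p v12]]] : exists v1 v2 : V, [/\ v1 \in pts, v2 \in pts & v1 != v2].
  by apply/card_gt1P; rewrite card_pts; lia.
have [Q [hQ Q0 Qp Qv1 Qv2]] := conic_through hdeg hline v1 v2.
have nl : lineless Q by apply: (conic_lineless hline hQ _ Q0 Qp); lia.
have v1Z : v1 \in zeros Q by rewrite inE v1p Qv1 eqxx.
have v2Z : v2 \in zeros Q by rewrite inE v2p Qv2 eqxx.
have cQ := conic_card hQ nl v12 v1Z v2Z.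
have [R Rp /card_gt2P[a [b [c [[]]]]]] := external_lines hQ nl v12 v1Z v2Z q5.
move=> /setIdP[aR /eqP aQ] /setIdP[bR /eqP bQ] /setIdP[cR /eqP cQ0] [ab bc ca].
have [ap bp cp] : [/\ a \in pts, b \in pts & c \in pts] by rewrite !(@line_pts _ R).
have [Ra Rb Rc] : [/\ R \in line a, R \in line b & R \in line c].
  by rewrite (line_sym ap Rp) (line_sym bp Rp) (line_sym cp Rp).
pose G := linform a * (linform b * (linform c * Q)).
have hG : form 5 G by do !apply: (@dhomogM _ _ _ 1); rewrite ?linform_homog.
have G0 : G != 0 by rewrite !mulf_neq0 // linform_neq0 // pts_neq0.
have vG : vanishes_at p G by do !apply: vanishesMl.
exists G; split=> //; apply/eqP; rewrite eqn_leq (quintic_bound hline q5 hG G0 vG) /=.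
rewrite /G !zerosM -!line_zeros.
have U (A B : {set V}) : (#|A :|: B| + #|A :&: B| = #|A| + #|B|)%N by rewrite cardsUI.
have cl e : e \in pts -> #|line e| = q.+1 by move=> ep; rewrite card_line // pts_neq0.
have := U (line c) (zeros Q); rewrite cQ0 cards0 addn0 cl // cQ => E1.
have := U (line b) (line c :|: zeros Q); rewrite setIUr bQ setU0 cl // => E2.
have := U (line a) (line b :|: (line c :|: zeros Q)); rewrite !setIUr aQ setU0 cl // => E3.
have I3 : (#|line a :&: line b :|: line a :&: line c| <= 1)%N.
  apply: leq_trans (_ : (#|[set R]| <= 1)%N); last by rewrite cards1.
  apply: subset_leq_card; apply/subsetP => v; rewrite in_set1.
  have uniqR e : e \in pts -> R \in line e -> a != e -> v \in line a :&: line e -> v == R.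
    move=> ep Re ae /setIP[va ve]; apply: contraNT ae => vR; apply/eqP.
    exact: (join_unique ap ep vR).
  by rewrite in_setU => /orP[]; apply: uniqR => //; rewrite eq_sym.
have I2 := card_meet_le1 bp cp bc.
move: E1 E2 E3 I2 I3; clear; move: #|_ :|: (_ :|: (_ :|: zeros Q))| #|_ :|: (_ :|: zeros Q)|.
by move: #|_ :|: zeros Q| #|_ :|: _ :&: _| #|line b :&: _| q => *; lia.
Qed.

End Extremal.

(** * Fractions regular at a point of the plane *)

Section Regular.
Variables (F : finFieldType).
Notation V := 'rV[F]_3.
Notation q := #|F|.
Notation pts := (pts F).
Notation form d G := (is_true (G \is d.-homog)).
Notation poly3 := {mpoly F[3]}.
Notation K := (homog_frac F).
Notation tf := (@tofrac {mpoly F[3]}).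
Implicit Types (G N D : {mpoly F[3]}) (a : V) (f : K).

Lemma mmap_homog n (R : comNzRingType) (h : {rmorphism F -> R})
    (v : 'I_n -> R) c d (G : {mpoly F[n]}) :
  G \is d.-homog -> mmap h (fun i => v i * c) G = mmap h v G * c ^+ d.
Proof.
move=> /dhomogP hG; rewrite /mmap mulr_suml !big_seq; apply: eq_bigr => m mG.
rewrite -mulrA; congr (_ * _); have hm : mdeg m = d by exact: hG.
rewrite -hm mdegE -prodrXr -big_split /=; apply: eq_bigr => i _.
by rewrite exprMn.
Qed.

Lemma form_X (j : 'I_3) : form 1 ('X_j : poly3).
Proof. by rewrite dhomogX /= mdeg1. Qed.

Lemma form_Xn (j : 'I_3) k : form k ('X_j ^+ k : poly3).
Proof. by have := dhomogMn k (form_X j); rewrite mul1n. Qed.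

Lemma tofrac_eq_inj G H : tf G = tf H -> G = H.
Proof. by move/eqP; rewrite tofrac_eq => /eqP. Qed.

Lemma tf_neq0 G : G != 0 -> tf G != 0.
Proof. by rewrite -tofrac0 tofrac_eq. Qed.

Lemma ev_neq0 G a : ev G a != 0 -> G != 0.
Proof. by apply: contraNneq => ->; rewrite /ev meval0. Qed.

Lemma xcoord_neq0 (j : 'I_3) : xcoord F j != 0.
Proof.
by rewrite tf_neq0 // (@ev_neq0 _ (const_mx 1)) // /ev mevalXU mxE oner_neq0.
Qed.

Definition regular_at a f y := exists d N D,
  [/\ form d N, form d D, ev D a != 0, f = tf N / tf D & y = ev N a / ev D a].

Lemma regular_uniq a f y y' : regular_at a f y -> regular_at a f y' -> y = y'.
Proof.
move=> [d [N [D [_ _ Da -> ->]]]] [d' [N' [D' [_ _ Da' E ->]]]].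
have : N * D' = N' * D.
  apply: tofrac_eq_inj; rewrite !rmorphM /=; move/eqP: E; rewrite eqr_div ?tf_neq0 ?(@ev_neq0 _ a) //.
  by move/eqP.
move/(congr1 (fun G => ev G a)); rewrite !evM => E'.
by apply/eqP; rewrite eqr_div // E'.
Qed.

Lemma regular_scale a c f y : c != 0 -> regular_at a f y -> regular_at (c *: a) f y.
Proof.
move=> c0 [d [N [D [hN hD Da -> ->]]]]; exists d, N, D; split=> //.
  by rewrite (evZ _ _ hD) mulf_neq0 // expf_neq0.
by rewrite (evZ _ _ hN) (evZ _ _ hD) -mulf_div divff ?mul1r // expf_neq0.
Qed.

Lemma regularD a f g y z : regular_at a f y -> regular_at a g z -> regular_at a (f + g) (y + z).
Proof.
move=> [d [N [D [hN hD Da -> ->]]]] [e [M [E [hM hE Ea -> ->]]]].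
exists (d + e)%N, (N * E + M * D), (D * E); split.
- by apply: rpredD; [|rewrite addnC]; apply: dhomogM.
- exact: dhomogM.
- by rewrite evM mulf_neq0.
- by rewrite rmorphD !rmorphM /= addf_div // tf_neq0 // (@ev_neq0 _ a).
- by rewrite evD !evM addf_div.
Qed.

Lemma regularM a f g y z : regular_at a f y -> regular_at a g z -> regular_at a (f * g) (y * z).
Proof.
move=> [d [N [D [hN hD Da -> ->]]]] [e [M [E [hM hE Ea -> ->]]]].
exists (d + e)%N, (N * M), (D * E); split; rewrite ?dhomogM ?evM ?mulf_neq0 //.
  by rewrite !rmorphM /= mulf_div.
by rewrite mulf_div.
Qed.

End Regular.

(** * Charts of the blow-up at a rational point *)

Section BlowupPoints.
Variables (F : finFieldType) (L : fieldExtType F) (p : 'I_3 -> L).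
Hypothesis hdeg : closed_point_degree p = 3%N.
Hypothesis hline : ~ on_rational_line p.
Notation V := 'rV[F]_3.
Notation q := #|F|.
Notation pts := (pts F).
Notation form d G := (is_true (G \is d.-homog)).
Notation poly3 := {mpoly F[3]}.
Notation K := (homog_frac F).
Notation tf := (@tofrac {mpoly F[3]}).
Implicit Types (G N D : {mpoly F[3]}) (a : V) (f : K) (c : blowup_chart p).

(** Take two further points on a line m through a, and a conic through p and
    these two points.  It meets m in at most two points, so not in a. *)
Lemma avoid_point a : a != 0 -> exists Q, [/\ form 2 Q, vanishes_at p Q & ev Q a != 0].
Proof.
move=> a0; have rp := normalize_pts a0.
have [m mr _] := other_on_line 0 rp; have mp := line_pts mr.
have rm : normalize a \in line m by rewrite (line_sym mp rp).
have [v1 [v2 [/setD1P[v1r v1m] /setD1P[v2r v2m] v12]]] : exists v1 v2,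
    [/\ v1 \in line m :\ normalize a, v2 \in line m :\ normalize a & v1 != v2].
  apply/card_gt1P; have := cardsD1 (normalize a) (line m); rewrite rm (card_line (pts_neq0 mp)).
  by rewrite add1n => -[<-]; apply: q_gt1.
have [Q [hQ Q0 Qp Qv1 Qv2]] := conic_through hdeg hline v1 v2.
exists Q; split=> //; apply/negP => /eqP Qa.
have nl := conic_lineless hline hQ (q_gt1 F) Q0 Qp.
have := leq_trans (leq_addr _ _) (line_bound hQ mp (nl m mp)); rewrite leqNgt => /negP[].
apply/card_gt2P; exists (normalize a), v1, v2; split; last by rewrite eq_sym v1r v12 v2r.
have Z v : v \in line m -> ev Q v = 0 -> v \in line m :&: zeros Q.
  by move=> vm Qv; rewrite in_setI vm inE (line_pts vm) Qv eqxx.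
by split; apply: Z => //; rewrite /normalize (evZ _ _ hQ) Qa mulr0.
Qed.

Lemma regular_plane j f a : plane_ring j f -> a 0 j != 0 ->
  exists y, regular_at a f y.
Proof.
move=> [d [G [hG ->]]] aj; exists (ev G a / ev ('X_j ^+ d) a), d, G, ('X_j ^+ d); split=> //.
- exact: form_Xn.
- by rewrite /ev rmorphXn /= mevalXU expf_neq0.
- by rewrite rmorphXn.
Qed.

(** Where the generator g of the inverse image ideal has a nonzero value, the
    quotients h / g that define the chart are regular. *)
Lemma blowup_regular c a y : a 0 (bc_idx c) != 0 -> regular_at a (bc_gen c) y -> y != 0 ->
  forall f, blowup_ring c f -> exists z, regular_at a f z.
Proof.
move=> aj rg y0 f; elim=> {f} [f /regular_plane|h|f g _ [z1 r1] _ [z2 r2]|f g _ [z1 r1] _ [z2 r2]].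
- exact.
- move=> [d [H [hH _ hE]]].
  have [z rz] : exists z, regular_at a h z.
    by apply: (@regular_plane (bc_idx c)) => //; exists d, H.
  exists (z * y^-1); apply: regularM => //.
  case: rg => e [N [D [hN hD Da -> yE]]]; exists e, D, N; split=> //.
  + by apply: contraNneq y0 => Na; rewrite yE Na mul0r.
  + by rewrite invf_div.
  + by rewrite yE invf_div.
- by exists (z1 + z2); apply: regularD.
- by exists (z1 * z2); apply: regularM.
Qed.

Section Point.
Variable P : rational_point (Z p).
Let c : blowup_chart p := pt_chart P.
Let j := bc_idx c.
Let phi := pt_eval P.

(** The image in the plane of a rational point of the blow-up. *)
Definition pt_vec : V :=
  \row_i pt_eval P (xcoord F i / xcoord F (bc_idx (pt_chart P : blowup_chart p))).

Let phi_scalar t : phi (tf t%:MP) = t.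
Proof. by have [H _ _] := pt_evalP P; apply: H. Qed.

Let phiD f g : blowup_ring c f -> blowup_ring c g -> phi (f + g) = phi f + phi g.
Proof. by have [_ H _] := pt_evalP P; apply: H. Qed.

Let phiM f g : blowup_ring c f -> blowup_ring c g -> phi (f * g) = phi f * phi g.
Proof. by have [_ _ H] := pt_evalP P; apply: H. Qed.

(** Dehomogenization with respect to the j-th coordinate, as a substitution, so
    that it is a ring morphism. *)
Let dehomog (G : poly3) : K := mmap (tf \o @mpolyC 3 F) (fun i => xcoord F i / xcoord F j) G.

Let dehomogE d G : form d G -> dehomog G = tf G / xcoord F j ^+ d.
Proof.
move=> hG; rewrite /dehomog (mmap_homog _ _ _ hG) exprVn; congr (_ / _).
elim/mpoly_ring_ind: (G) => [t|i|g h IHg IHh|g h IHg IHh].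
- by rewrite mmapC.
- by rewrite mmapX mmap1U.
- by rewrite !rmorphD /= IHg IHh.
- by rewrite !rmorphM /= IHg IHh.
Qed.

Let plane_sub f : plane_ring j f -> blowup_ring c f. Proof. exact: BlowupBase. Qed.

Let phi_dehomog G : blowup_ring c (dehomog G) /\ phi (dehomog G) = ev G pt_vec.
Proof.
rewrite /dehomog /ev; elim/mpoly_ring_ind: G => [t|i|g h [Rg Eg] [Rh Eh]|g h [Rg Eg] [Rh Eh]].
- rewrite mmapC mevalC; split; last exact: phi_scalar.
  apply: plane_sub; exists 0%N, t%:MP; rewrite expr0 divr1; split=> //.
  by rewrite -[t%:MP]mulr1 mul_mpolyC rpredZ // dhomog1.
- rewrite mmapX mmap1U mevalXU mxE; split=> //.
  by apply: plane_sub; exists 1%N, 'X_i; split; [exact: form_X|rewrite expr1].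
- by rewrite !rmorphD /=; split; [exact: BlowupAdd|rewrite phiD // Eg Eh].
- by rewrite !rmorphM /=; split; [exact: BlowupMul|rewrite phiM // Eg Eh].
Qed.

Lemma phi_plane d G : form d G -> pt_eval P (tf G / xcoord F j ^+ d) = ev G pt_vec.
Proof. by move=> hG; rewrite -(dehomogE hG); exact: (phi_dehomog G).2. Qed.

Lemma pt_vec_idx : pt_vec 0 j = 1.
Proof.
rewrite mxE divff ?xcoord_neq0 //.
by have := phi_scalar 1; rewrite /= tofrac1.
Qed.

Lemma pt_vec_neq0 : pt_vec != 0.
Proof.
have := pt_vec_idx; apply: contra_eqN => /eqP ->; rewrite mxE.
by rewrite eq_sym oner_eq0.
Qed.

Let gen_ring : blowup_ring c (bc_gen c).
Proof. by have [d [G [hG _ E]]] := bc_gen_ideal c; apply: plane_sub; exists d, G. Qed.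

(** A rational point of the blow-up is not on the exceptional divisor: some h
    in the ideal of p is nonzero at the image of the point, and h is a multiple
    of the generator in the chart. *)
Lemma pt_eval_gen_neq0 : pt_eval P (bc_gen c) != 0.
Proof.
have [Q [hQ Qp Qa]] := avoid_point pt_vec_neq0.
apply: contraNneq Qa => g0; rewrite -(phi_plane hQ).
have IQ : point_ideal p j (tf Q / xcoord F j ^+ 2) by exists 2, Q.
rewrite -[X in pt_eval P X](divfK (bc_gen_neq0 c)) -/phi phiM //; last exact: BlowupFrac.
by rewrite /phi g0 mulr0.
Qed.

Lemma pt_eval_frac d H : form d H -> vanishes_at p H ->
  pt_eval P (tf H / xcoord F j ^+ d / bc_gen c) = ev H pt_vec / pt_eval P (bc_gen c).
Proof.
move=> hH vH; apply: (canRL (mulfK pt_eval_gen_neq0)).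
have IH : point_ideal p j (tf H / xcoord F j ^+ d) by exists d, H.
rewrite -[_ * _](phiM (BlowupFrac IH) gen_ring) divfK ?(bc_gen_neq0 c) //.
exact: phi_plane.
Qed.

Lemma chart_regular f : blowup_ring c f -> regular_at pt_vec f (pt_eval P f).
Proof.
move=> Rf; have [d [G [hG vG gE]]] := bc_gen_ideal c.
have xj : pt_vec 0 j != 0 by rewrite pt_vec_idx oner_neq0.
have Xd e : ev ('X_j ^+ e : poly3) pt_vec = 1.
  by rewrite /ev rmorphXn /= mevalXU pt_vec_idx expr1n.
have rg : regular_at pt_vec (bc_gen c) (ev G pt_vec).
  exists d, G, ('X_j ^+ d); split=> //.
  - exact: form_Xn.
  - by rewrite Xd oner_neq0.
  - by rewrite gE rmorphXn.
  - by rewrite Xd divr1.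
have G0 : ev G pt_vec != 0 by rewrite -(phi_plane hG) -gE pt_eval_gen_neq0.
have [z rz] := blowup_regular xj rg G0 Rf.
suff -> : pt_eval P f = z by [].
case: rz => e [N [D [hN hD Da fE zE]]].
have xe : xcoord F j ^+ e != 0 by rewrite expf_neq0 // xcoord_neq0.
have : f * (tf D / xcoord F j ^+ e) = tf N / xcoord F j ^+ e.
  have D0 := tf_neq0 (ev_neq0 Da); rewrite fE mulrA.
  by congr (_ / _); exact: divfK.
move/(congr1 (pt_eval P)); rewrite -/phi phiM //; last by apply: plane_sub; exists e, D.
by rewrite /phi !phi_plane // zE => <-; rewrite mulfK.
Qed.

(** The local ring at a rational point of the blow-up is the local ring of the
    plane at its image. *)
Lemma local_regular f : local_ring P f <-> exists y, regular_at pt_vec f y.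
Proof.
split=> [[r [s [Rr Rs s0 ->]]]|[y [d [N [D [hN hD Da -> _]]]]]].
  have r1 := chart_regular Rr; have [e [N [D [hN hD Da sE yE]]]] := chart_regular Rs.
  exists (pt_eval P r * (pt_eval P s)^-1); apply: regularM => //.
  exists e, D, N; split=> //.
  - by apply: contraNneq s0 => Na; rewrite yE Na mul0r.
  - by rewrite sE invf_div.
  - by rewrite yE invf_div.
exists (tf N / xcoord F j ^+ d), (tf D / xcoord F j ^+ d); split.
- by apply: plane_sub; exists d, N.
- by apply: plane_sub; exists d, D.
- by rewrite phi_plane.
- rewrite -mulf_div divff ?invr_eq0 ?mulr1 //.
  by rewrite expf_neq0 // xcoord_neq0.
Qed.

End Point.
End BlowupPoints.

(** * Rational points of the blow-up *)

Section RationalPoints.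
Variables (F : finFieldType) (L : fieldExtType F) (p : 'I_3 -> L).
Hypothesis hdeg : closed_point_degree p = 3%N.
Hypothesis hline : ~ on_rational_line p.
Notation V := 'rV[F]_3.
Notation q := #|F|.
Notation pts := (pts F).
Notation form d G := (is_true (G \is d.-homog)).
Notation poly3 := {mpoly F[3]}.
Notation K := (homog_frac F).
Notation tf := (@tofrac {mpoly F[3]}).

Definition plane_pt (P : rational_point (Z p)) : V := normalize (pt_vec P).

Lemma plane_pt_pts P : plane_pt P \in pts.
Proof. exact/normalize_pts/pt_vec_neq0. Qed.

Lemma local_plane_pt P f : local_ring P f <-> exists y, regular_at (plane_pt P) f y.
Proof.
rewrite (local_regular hdeg hline) /plane_pt /normalize.
have l0 : first_coord (pt_vec P) != 0 by rewrite first_coord_eq0 pt_vec_neq0.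
split=> -[y ry]; exists y; first by apply: regular_scale => //; rewrite invr_eq0.
by rewrite -[pt_vec P]scale1r -(divff l0) -scalerA; apply: regular_scale.
Qed.

(** A linear form vanishing at a but not at b is a denominator at b only. *)
Lemma regular_separates (a b : V) : a \in pts -> b \in pts ->
  (forall f : K, (exists y, regular_at a f y) <-> (exists y, regular_at b f y)) -> a = b.
Proof.
move=> ap bp E; apply/eqP; apply: contraT => ab.
have [e [ep ae be]] := avoid_line ap ab.
have eb : ev (linform e) b != 0 by rewrite -inc_ev; move: be; rewrite in_line bp.
have ea : ev (linform e) a = 0 by apply/eqP; rewrite -inc_ev line_inc.
have /rV0Pn[i ai] := pts_neq0 ap.
have [] := (E (tf 'X_i / tf (linform e))).2.
  exists (ev 'X_i b / ev (linform e) b), 1%N, 'X_i, (linform e).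
  by split; rewrite ?form_X ?linform_homog.
move=> _ [d [N [D [_ _ Da + _]]]] => /eqP.
rewrite eqr_div ?tf_neq0 ?(ev_neq0 eb) ?(ev_neq0 Da) // -!rmorphM => /eqP/tofrac_eq_inj.
move/(congr1 (fun G => ev G a)); rewrite !evM ea mulr0 /ev mevalXU => /eqP.
by rewrite mulf_eq0 (negPf ai) (negPf Da).
Qed.

Lemma same_plane_pt P Q : same_point P Q <-> plane_pt P = plane_pt Q.
Proof.
split=> [E|E f]; last by rewrite !local_plane_pt E.
by apply: regular_separates; rewrite ?plane_pt_pts // => f; rewrite -!local_plane_pt.
Qed.

(** Blow-up charts are given by any nonzero element of the ideal; a conic through
    p that misses v gives one which contains a point over v.  The evaluation has
    to be defined on the whole function field, hence the use of choice. *)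
Lemma plane_pt_surj v : v \in pts -> exists P, plane_pt P = v.
Proof.
move=> vp; have v0 := pts_neq0 vp.
have /rV0Pn[j vj] := v0.
have [Q [hQ Qp Qv]] := avoid_point hdeg hline v0.
pose g : K := tf Q / xcoord F j ^+ 2.
have Ig : point_ideal p j g by exists 2, Q.
have g0 : g != 0.
  apply: mulf_neq0; first exact: tf_neq0 (ev_neq0 Qv).
  by rewrite invr_eq0 expf_neq0 // xcoord_neq0.
pose c := BlowupChart Ig g0.
pose phi (f : K) : F := epsilon (inhabits 0) (regular_at v f).
have phiE f y : regular_at v f y -> phi f = y.
  move=> fy; have ex : exists z, regular_at v f z by exists y.
  exact: regular_uniq (epsilon_spec (inhabits 0) _ ex) fy.
have Xv e : ev ('X_j ^+ e : poly3) v = v 0 j ^+ e by rewrite /ev rmorphXn /= mevalXU.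
have rg : regular_at v g (ev Q v / v 0 j ^+ 2).
  exists 2, Q, ('X_j ^+ 2); rewrite Xv; split=> //; first exact: form_Xn.
    exact: expf_neq0.
  by rewrite /g rmorphXn.
have y0 : ev Q v / v 0 j ^+ 2 != 0 by rewrite mulf_neq0 // invr_eq0 expf_neq0.
have R f : blowup_ring c f -> exists y, regular_at v f y
  by exact: (@blowup_regular _ _ _ c v _ vj rg y0 f).
have phi_scalar t : regular_at v (tf t%:MP) t.
  exists 0%N, t%:MP, 1; split; rewrite ?dhomog1 //.
  - by rewrite -[t%:MP]mulr1 mul_mpolyC rpredZ // dhomog1.
  - by rewrite /ev meval1 oner_neq0.
  - by rewrite tofrac1 divr1.
  - by rewrite /ev meval1 mevalC divr1.
have phiP : @is_eval F K (Z p) c phi.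
  split=> [t|f g' /R[y fy] /R[z gz]|f g' /R[y fy] /R[z gz]].
  - exact: phiE (phi_scalar t).
  - by rewrite (phiE _ _ fy) (phiE _ _ gz); apply/phiE/regularD.
  - by rewrite (phiE _ _ fy) (phiE _ _ gz); apply/phiE/regularM.
exists (RationalPoint phiP); rewrite /plane_pt.
have -> : pt_vec (RationalPoint phiP) = (v 0 j)^-1 *: v.
  apply/rowP => i; rewrite !mxE /=; apply: phiE.
  exists 1%N, 'X_i, 'X_j; split; rewrite ?form_X //.
  - by rewrite /ev mevalXU.
  - by rewrite /ev !mevalXU mulrC.
by rewrite normalizeZ ?invr_eq0 // normalize_id.
Qed.

Lemma points_exist : exists (n : nat) (P : 'I_n -> rational_point (Z p)), enumerates_points P.
Proof.
have [P PE] := choice (fun (i : 'I_#|pts|) P => plane_pt P = enum_val i)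
  (fun i => plane_pt_surj (enum_valP i)).
exists #|pts|, P; split=> [Q|i j].
  have Qp := plane_pt_pts Q; exists (enum_rank_in Qp (plane_pt Q)).
  by apply/same_plane_pt; rewrite PE enum_rankK_in.
by move/same_plane_pt; rewrite !PE; apply: enum_val_inj.
Qed.

Section Enumeration.
Variables (n : nat) (P : 'I_n -> rational_point (Z p)).
Hypothesis enumP : enumerates_points P.

Lemma plane_pt_inj : injective (fun i => plane_pt (P i)).
Proof. by move=> i j /same_plane_pt; apply: enumP.2. Qed.

Lemma plane_pt_onto v : v \in pts -> exists i, plane_pt (P i) = v.
Proof.
move=> /plane_pt_surj[Q QE]; have [i /same_plane_pt QP] := enumP.1 Q.
by exists i; rewrite -QP.
Qed.

Lemma card_plane_pt (S : {set V}) : S \subset pts ->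
  #|[set i | plane_pt (P i) \in S]| = #|S|.
Proof.
move=> /subsetP sS; rewrite -(card_imset _ plane_pt_inj); apply: eq_card => v.
apply/imsetP/idP => [[i]|vS]; first by rewrite inE => iS ->.
by have [i iE] := plane_pt_onto (sS v vS); exists i; rewrite ?inE iE.
Qed.

Lemma enum_length : n = (q ^ 2 + q + 1)%N.
Proof.
rewrite -card_pts -(card_plane_pt (subxx _)) -[LHS]card_ord.
by apply: eq_card => i; rewrite !inE; have := plane_pt_pts (P i); rewrite inE.
Qed.

End Enumeration.
End RationalPoints.

(** * Global sections are quintic forms *)

Section GlobalSections.
Variables (F : finFieldType) (L : fieldExtType F) (p : 'I_3 -> L).
Hypothesis hdeg : closed_point_degree p = 3%N.
Hypothesis hline : ~ on_rational_line p.
Notation V := 'rV[F]_3.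
Notation q := #|F|.
Notation pts := (pts F).
Notation form d G := (is_true (G \is d.-homog)).
Notation poly3 := {mpoly F[3]}.
Notation K := (homog_frac F).
Notation tf := (@tofrac {mpoly F[3]}).
Implicit Types (G H N D : {mpoly F[3]}) (s f : K).

Lemma quintic_section G : form 5 G -> vanishes_at p G -> global_section (@L5 F L p) (tf G).
Proof.
move=> hG vG c; rewrite /L5 /O_Z expr1 invfM mulrA.
by apply: BlowupFrac; exists 5, G.
Qed.

Lemma tf_add N D N' D' : tf D != 0 -> tf D' != 0 ->
  tf N / tf D + tf N' / tf D' = tf (N * D' + N' * D) / tf (D * D').
Proof. by move=> D0 D0'; rewrite rmorphD !rmorphM /= (addf_div _ _ D0 D0'). Qed.

Lemma tf_mul N D N' D' : tf N / tf D * (tf N' / tf D') = tf (N * N') / tf (D * D').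
Proof. by rewrite !rmorphM /= mulf_div. Qed.

(** In a chart given by G0, all denominators are products of powers of the
    coordinate and of G0. *)
Lemma chart_form (j : 'I_3) (G0 : poly3) e (Ig : point_ideal p j (tf G0 / xcoord F j ^+ e))
    (g0 : tf G0 / xcoord F j ^+ e != 0) : form e G0 ->
  forall f, blowup_ring (BlowupChart Ig g0) f -> exists a b N,
    form (a + e * b) N /\ f = tf N / tf ('X_j ^+ a * G0 ^+ b).
Proof.
move=> hG.
have G00 : G0 != 0 by apply: contraNneq g0 => ->; rewrite tofrac0 mul0r.
have X0 : ('X_j : poly3) != 0.
  by have := xcoord_neq0 F j; rewrite /xcoord -tofrac0 tofrac_eq.
have nz a b : tf ('X_j ^+ a * G0 ^+ b) != 0 by rewrite tf_neq0 // mulf_neq0 // expf_neq0.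
have DE a b a' b' : ('X_j : poly3) ^+ (a + a') * G0 ^+ (b + b') =
    'X_j ^+ a * G0 ^+ b * ('X_j ^+ a' * G0 ^+ b') by rewrite !exprD mulrACA.
move=> f; elim=> {f} [f [d [G [hF ->]]]|h [d [G [hF _ ->]]]
  |f g _ [a [b [N [hN ->]]]] _ [a' [b' [N' [hN' ->]]]]
  |f g _ [a [b [N [hN ->]]]] _ [a' [b' [N' [hN' ->]]]]] /=.
- by exists d, 0%N, G; rewrite muln0 addn0 expr0 mulr1 rmorphXn.
- exists d, 1%N, (G * 'X_j ^+ e); rewrite muln1 expr1; split.
    by apply: dhomogM => //; apply: form_Xn.
  rewrite !rmorphM !rmorphXn /= invf_div -/(xcoord F j) mulf_div.
  by [].
- exists (a + a')%N, (b + b')%N, (N * ('X_j ^+ a' * G0 ^+ b') + N' * ('X_j ^+ a * G0 ^+ b)); split.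
    have h x y : form (x + e * y) ('X_j ^+ x * G0 ^+ y).
      by rewrite dhomogM ?dhomogMn // form_Xn.
    apply: rpredD.
      have -> : (a + a' + e * (b + b') = a + e * b + (a' + e * b'))%N by rewrite mulnDr; lia.
      by rewrite dhomogM.
    have -> : (a + a' + e * (b + b') = a' + e * b' + (a + e * b))%N by rewrite mulnDr; lia.
      by rewrite dhomogM.
  by rewrite DE (tf_add _ _ (nz a b) (nz a' b')).
- exists (a + a')%N, (b + b')%N, (N * N'); split.
    have -> : (a + a' + e * (b + b') = a + e * b + (a' + e * b'))%N by rewrite mulnDr; lia.
      by rewrite dhomogM.
  by rewrite DE tf_mul.
Qed.

Lemma fraction_regroup (E : fieldType) (n u g x t w : E) :
  n / (u * g) * (x * (t / w)) = x * t * n / (u * w * g).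
Proof. by rewrite !invfM; ring. Qed.

Lemma section_denominator s (j : 'I_3) (G0 : poly3) e : global_section (@L5 F L p) s ->
    form e G0 -> vanishes_at p G0 -> G0 != 0 ->
  exists a b N, [/\ form (5 + (a + e * b)) N & s = tf N / tf ('X_j ^+ a * G0 ^+ b)].
Proof.
move=> gs hG vG G00.
have Ig : point_ideal p j (tf G0 / xcoord F j ^+ e) by exists e, G0.
have xe k : xcoord F j ^+ k != 0 by rewrite expf_neq0 // xcoord_neq0.
have g0 : tf G0 / xcoord F j ^+ e != 0.
  by apply: mulf_neq0; [exact: tf_neq0|rewrite invr_eq0].
have [a [b [N [hN]]]] := chart_form hG (gs (BlowupChart Ig g0)).
rewrite /L5 /O_Z /= expr1 => sE.
exists (a + e)%N, b, ('X_j ^+ 5 * G0 * N); split.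
  rewrite (_ : (5 + (a + e + e * b))%N = (5 + e + (a + e * b))%N); last by lia.
  by rewrite !dhomogM // form_Xn.
have eN0 := mulf_neq0 (xe 5) g0.
rewrite -[LHS](divfK eN0) sE !rmorphM !rmorphXn /= exprD /xcoord.
by rewrite fraction_regroup.
Qed.

(** The homogenized minimal polynomial of p i / p j over F.  It is monic in the
    i-th variable, which is what the last two properties express: its value where
    the j-th coordinate is zero, and its independence of the third variable. *)
Lemma binary_form (i j : 'I_3) : i != j -> exists n H,
  [/\ form n H, vanishes_at p H &
      forall (R : comNzRingType) (h : {rmorphism F -> R}) v, v j = 0 ->
        mmap h v H = v i ^+ n] /\
      (forall (R : comNzRingType) (h : {rmorphism F -> R}) v w, v i = w i -> v j = w j ->
        mmap h v H = mmap h w H).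
Proof.
move=> ij; pose th := p i / p j.
have [m mE] : exists m : {poly F}, minPoly 1 th = map_poly (in_alg L) m.
  by apply/polyOver1P; apply: minPolyOver.
have mmon : m \is monic.
  by have := monic_minPoly 1 th; rewrite mE map_monic.
have pj : p j != 0 by apply: coord_neq0.
exists (size m).-1,
  (\sum_(k < size m) m`_k *: ('X_i ^+ k * 'X_j ^+ ((size m).-1 - k))); split; last first.
  move=> R h v w vi vj; rewrite !(raddf_sum (mmap h _)); apply: eq_bigr => k _ /=.
  by rewrite !mmapZ !rmorphM !rmorphXn /= !mmapX !mmap1U vi vj.
split.
- apply: rpred_sum => k _; rewrite rpredZ //.
  by have := dhomogM (form_Xn F i k) (form_Xn F j ((size m).-1 - k));
     rewrite subnKC // -ltnS prednK // (leq_trans _ (ltn_ord k)).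
- rewrite /vanishes_at (raddf_sum (map_mpoly (in_alg L))) (raddf_sum (meval p)) /=.
  have := root_minPoly 1 th; rewrite mE /root horner_coef size_map_poly => /eqP E.
  move/(congr1 (fun z => p j ^+ (size m).-1 * z)): E; rewrite mulr0 mulr_sumr; apply: etrans.
  apply: eq_bigr => k _ /=.
  rewrite coef_map /= map_mpolyZ mevalZ rmorphM !rmorphXn /= !map_mpolyX mevalM !rmorphXn /= !mevalXU.
  rewrite /th expr_div_n [RHS]mulrCA; congr (_ * _).
  have -> : p j ^+ (size m).-1 = p j ^+ ((size m).-1 - k) * p j ^+ k.
    by rewrite -exprD subnK // -ltnS prednK // (leq_trans _ (ltn_ord k)).
  rewrite -[RHS]mulrA [X in _ = _ * X]mulrC divfK ?expf_neq0 //.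
  by rewrite mulrC.
- move=> R h v vj.
  have sm : (0 < size m)%N by rewrite size_poly_gt0 monic_neq0.
  have lt : ((size m).-1 < size m)%N by rewrite prednK.
  rewrite (raddf_sum (mmap h v)) (bigD1 (Ordinal lt)) //= big1 ?addr0 => [|k nk].
    rewrite mmapZ rmorphM !rmorphXn /= !mmapX !mmap1U subnn expr0 mulr1.
    by have := mmon; rewrite monicE lead_coefE => /eqP ->; rewrite rmorph1 mul1r.
  rewrite mmapZ rmorphM !rmorphXn /= !mmapX !mmap1U vj expr0n.
  have lk : (k < (size m).-1)%N by rewrite ltn_neqAle nk -ltnS prednK // ltn_ord.
  by rewrite subn_eq0 leqNgt lk !mulr0.
Qed.

Lemma mmap_self G : mmap (@mpolyC 3 F) (fun i => 'X_i) G = G.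
Proof.
elim/mpoly_ring_ind: G => [t|i|g h IHg IHh|g h IHg IHh].
- by rewrite mmapC.
- by rewrite mmapX mmap1U.
- by rewrite rmorphD /= IHg IHh.
- by rewrite rmorphM /= IHg IHh.
Qed.

Lemma mmap_polyC G :
  mmap (polyC \o @mpolyC 3 F) (fun i => ('X_i)%:P) G = G%:P.
Proof.
elim/mpoly_ring_ind: G => [t|i|g h IHg IHh|g h IHg IHh].
- by rewrite mmapC.
- by rewrite mmapX mmap1U.
- by rewrite rmorphD /= IHg IHh polyCD.
- by rewrite rmorphM /= IHg IHh polyCM.
Qed.

Lemma tf_cross N D N' D' : D != 0 -> D' != 0 -> tf N / tf D = tf N' / tf D' ->
  N * D' = N' * D.
Proof.
move=> D0 D0' /eqP; rewrite (eqr_div _ _ (tf_neq0 D0) (tf_neq0 D0')) => /eqP E.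
by apply: (@tofrac_eq_inj F); rewrite !(rmorphM tf).
Qed.

(** Read the section in two charts.  The binary form in the third and the first
    coordinates gives a denominator D1 monic in the third coordinate; the one in
    the second and the first coordinates gives a denominator D2 free of it.
    Euclidean division of N1 by D1 then has remainder zero, because D2 times the
    remainder is a multiple of D1 of smaller degree. *)
Lemma section_poly s : global_section (@L5 F L p) s ->
  exists2 G, form 5 G & s = tf G.
Proof.
move=> gs; pose z0 : 'I_3 := 0; pose z1 : 'I_3 := 1; pose z2 : 'I_3 := ord_max.
have [n1 [H1 [[hH1 vH1 e1] _]]] := @binary_form z2 z0 isT.
have [n2 [H2 [[hH2 vH2 e2] dep2]]] := @binary_form z1 z0 isT.
have nz n (H : poly3) (i j : 'I_3) : i != j ->
    (forall (R : comNzRingType) (h : {rmorphism F -> R}) v, v j = 0 -> mmap h v H = v i ^+ n) ->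
    H != 0.
  move=> ij e; have := e F idfun (fun k => (k == i)%:R).
  rewrite eq_sym (negPf ij) eqxx expr1n => /(_ erefl) E.
  by apply/eqP => H0; move/eqP: E; rewrite H0 mmap0 eq_sym oner_eq0.
have H10 : H1 != 0 by apply: nz e1.
have H20 : H2 != 0 by apply: nz e2.
have [a [b [N1 [hN1 s1]]]] := section_denominator z2 gs hH1 vH1 H10.
have [a' [b' [N2 [hN2 s2]]]] := section_denominator z0 gs hH2 vH2 H20.
have X0 (j : 'I_3) : ('X_j : poly3) != 0.
  by have := xcoord_neq0 F j; rewrite /xcoord -tofrac0 tofrac_eq.
set D1 := 'X_z2 ^+ a * H1 ^+ b in s1; set D2 := 'X_z0 ^+ a' * H2 ^+ b' in s2.
have D10 : D1 != 0 by rewrite mulf_neq0 // expf_neq0.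
have D20 : D2 != 0 by rewrite mulf_neq0 // expf_neq0.
have hD1 : form (a + n1 * b) D1 by rewrite dhomogM ?dhomogMn // form_Xn.
have cross : N1 * D2 = N2 * D1.
  by apply: tf_cross => //; rewrite -s1 -s2.
(* psi expands a polynomial in powers of the third variable *)
pose v (i : 'I_3) : poly3 := if i == z2 then 0 else 'X_i.
pose w (i : 'I_3) : poly3 := (i == z2)%:R.
pose psi := line_poly (@mpolyC 3 F) v w.
have psiM : {morph psi : f g / f * g} by move=> f g; apply: rmorphM.
have psiX G : (psi G).['X_z2] = G.
  rewrite /psi horner_line_poly -[RHS]mmap_self; apply: eq_bigr => m _; congr (_ * _).
  apply: eq_bigr => i _; congr (_ ^+ _); rewrite /v /w.
  by case: (eqVneq i z2) => [->|_] /=; rewrite ?mul1r ?add0r // mul0r addr0.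
have psiD1 : psi D1 \is monic.
  have [sz cf] := line_poly_homog (@mpolyC 3 F) v w hD1.
  have w1 : mmap (@mpolyC 3 F) w D1 = 1.
    rewrite rmorphM !rmorphXn /= mmapX mmap1U e1 // /w eqxx !expr1n mulr1 //.
  rewrite w1 in cf; rewrite monicE lead_coefE.
  suff -> : size (psi D1) = (a + n1 * b).+1 by rewrite /= cf.
  apply/eqP; rewrite eqn_leq sz /= ltnNge; apply/negP => sz'.
  by move: cf; rewrite nth_default // => /eqP; rewrite eq_sym oner_eq0.
have psiD2 : psi D2 = D2%:P.
  rewrite -mmap_polyC /psi /line_poly /D2 !rmorphM !rmorphXn /= !mmapX !mmap1U.
  congr (_ * _ ^+ _); first by rewrite /v /w scale0r addr0.
  by apply: dep2; rewrite /v /w scale0r addr0.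
have psic : psi N1 * D2%:P = psi N2 * psi D1 by rewrite -psiD2 -[LHS]psiM -[RHS]psiM cross.
pose S := Pdiv.Ring.rdivp (psi N1) (psi D1).
pose r := Pdiv.Ring.rmodp (psi N1) (psi D1).
have dv : psi N1 = S * psi D1 + r := Pdiv.RingMonic.rdivp_eq psiD1 _.
have r0 : r = 0.
  pose T := psi N2 - S * D2%:P.
  have E : r * D2%:P = T * psi D1.
    by rewrite /T mulrBl -psic dv mulrDl [S * psi D1 * _]mulrAC [X in X - _]addrC addrK.
  apply/eqP; apply: contraT => rn.
  have sr : (size r < size (psi D1))%N.
    by rewrite Pdiv.Ring.ltn_rmodp monic_neq0.
  have D2P : D2%:P != 0 by rewrite polyC_eq0.
  have : r * D2%:P != 0 by rewrite mulf_neq0.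
  rewrite {1}E mulf_eq0 negb_or => /andP[T0 _].
  have := congr1 (fun f : {poly poly3} => size f) E.
  rewrite size_mul // size_polyC D20 addn1 /= size_Mmonic // => sE.
  have : (0 < size T)%N by rewrite size_poly_gt0.
  move: sr; rewrite sE; case: (size T) => // k.
  by rewrite addSn /= ltnNge leq_addl.
have N1E : N1 = D1 * S.['X_z2].
  by rewrite -[LHS]psiX dv r0 addr0 hornerM psiX mulrC.
exists S.['X_z2].
  by apply: (homog_quotient D10 hD1); rewrite -N1E addnC.
by rewrite s1 N1E rmorphM mulrC mulKf // tf_neq0.
Qed.

End GlobalSections.

Lemma ex_least (A : nat -> Prop) : (exists k, A k) ->
  exists k, A k /\ forall j, A j -> (k <= j)%N.
Proof.
move=> [k]; elim/ltn_ind: k => k IH Ak.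
have [[j [Aj jk]]|no] := classic (exists j, A j /\ (j < k)%N); first exact: IH jk Aj.
exists k; split=> // j Aj; rewrite leqNgt; apply/negP => jk; apply: no.
by exists j.
Qed.

Lemma fraction_regroup_inv (E : fieldType) (a b c d : E) : a * b / (c * d) = a / (c * (d / b)).
Proof. by rewrite !invfM invrK; ring. Qed.

(** * Global sections vanish at the closed point *)

Section Vanishing.
Variables (F : finFieldType) (L : fieldExtType F) (p : 'I_3 -> L).
Hypothesis hdeg : closed_point_degree p = 3%N.
Hypothesis hline : ~ on_rational_line p.
Notation form d G := (is_true (G \is d.-homog)).
Notation poly3 := {mpoly F[3]}.
Notation K := (homog_frac F).
Notation tf := (@tofrac {mpoly F[3]}).
Implicit Types (G H N D : {mpoly F[3]}) (s f : K).

(** Restriction to the line through p and the coordinate point (0 : 1 : 0); the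
    parameter is 0 at p. *)
Let theta := line_poly (in_alg L) p (fun k => (k == 1)%:R).

Let thetaM G H : theta (G * H) = theta G * theta H.
Proof. exact: rmorphM. Qed.

Let thetaD G H : theta (G + H) = theta G + theta H.
Proof. exact: rmorphD. Qed.

Let theta0 G : (theta G).[0] = (map_mpoly (in_alg L) G).@[p].
Proof.
rewrite /theta horner_line_poly; elim/mpoly_ring_ind: G => [t|i|g h IHg IHh|g h IHg IHh].
- by rewrite mmapC map_mpolyC mevalC.
- by rewrite mmapX mmap1U map_mpolyX mevalXU mulr0 addr0.
- by rewrite !rmorphD /= IHg IHh.
- by rewrite !rmorphM /= IHg IHh.
Qed.

Let thetaX d : theta ('X_0 ^+ d) = (p 0 ^+ d)%:P.
Proof.
by rewrite /theta /line_poly rmorphXn /= mmapX mmap1U scale0r addr0 polyC_exp.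
Qed.

Let p0 d : p 0 ^+ d != 0. Proof. by rewrite expf_neq0 // coord_neq0. Qed.

Let order_at k G := exists2 u : {poly L}, theta G = 'X^k * u & u.[0] != 0.

Let order_exists G : theta G != 0 -> exists k, order_at k G.
Proof.
move=> G0; have [k [u]] := multiplicity_XsubC (theta G) 0.
rewrite G0 /= => u0 E; exists k, u; last by move: u0; rewrite /root.
by rewrite E subr0 mulrC.
Qed.

(** The fractions without pole at p along this line; they form a valuation
    ring. *)
Let of_order_ge f := exists N D k u (m : {poly L}),
  [/\ f = tf N / tf D, D != 0, theta D = 'X^k * u, u.[0] != 0 & theta N = 'X^k * m].

(** Choose g in the ideal of p with the smallest order k0 > 0 along the line.
    Every h / g with h in the ideal, and so the whole chart of g, is contained in
    the valuation ring.  As the section divided by g is in this chart, the order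
    of G is at least k0. *)
Lemma section_vanishes G : form 5 G -> global_section (@L5 F L p) (tf G) ->
  vanishes_at p G.
Proof.
move=> hG gs.
pose A k := exists e H, [/\ form e H, vanishes_at p H & order_at k H].
have [k0 [[e [G0 [hG0 vG0 [u0 G0E u00]]]] minA]] : exists k, A k /\ forall j, A j -> (k <= j)%N.
  apply: ex_least; have [n [H [[hH vH eH] _]]] := @binary_form F L p hline 1 0 isT.
  have H0 : theta H != 0.
    have [_ E] := line_poly_homog (in_alg L) p (fun k => (k == 1)%:R) hH.
    rewrite eH // expr1n in E.
    by apply/eqP => H0; move/eqP: E; rewrite -/theta H0 coef0 eq_sym oner_eq0.
  by have [k Hk] := order_exists H0; exists k, n, H.
have k0_gt0 : (0 < k0)%N.
  rewrite lt0n; apply: contraNneq u00 => k00.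
  by have := theta0 G0; rewrite G0E k00 expr0 mul1r => ->; rewrite vG0.
have G00 : G0 != 0.
  apply: contraNneq u00 => G00; move: G0E; rewrite G00 /theta /line_poly mmap0 => /esym/eqP.
  by rewrite mulf_eq0 expf_eq0 polyX_eq0 andbF /= => /eqP ->; rewrite horner0.
have xe k : xcoord F 0 ^+ k != 0 by rewrite expf_neq0 // xcoord_neq0.
pose g : K := tf G0 / xcoord F 0 ^+ e.
have Ig : point_ideal p 0 g by exists e, G0.
have g0 : g != 0 by apply: mulf_neq0; [exact: tf_neq0|rewrite invr_eq0].
have X0 k : ('X_0 : poly3) ^+ k != 0.
  by rewrite expf_neq0 //; have := xcoord_neq0 F 0; rewrite /xcoord -tofrac0 tofrac_eq.
have val f : blowup_ring (BlowupChart Ig g0) f -> of_order_ge f.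
  elim=> {f} [f [d [H [hH ->]]]|h [d [H [hH vH ->]]]
    |f1 f2 _ [N1 [D1 [k1 [u1 [m1 [-> D10 E1 U1 M1]]]]]]
      _ [N2 [D2 [k2 [u2 [m2 [-> D20 E2 U2 M2]]]]]]
    |f1 f2 _ [N1 [D1 [k1 [u1 [m1 [-> D10 E1 U1 M1]]]]]]
      _ [N2 [D2 [k2 [u2 [m2 [-> D20 E2 U2 M2]]]]]]] /=.
  - exists H, ('X_0 ^+ d), 0%N, (p 0 ^+ d)%:P, (theta H); split=> //.
    + by rewrite rmorphXn.
    + by rewrite thetaX expr0 mul1r.
    + by rewrite hornerC.
    + by rewrite expr0 mul1r.
  - have [m HE] : exists m, theta H = 'X^k0 * m.
      have [->|H0] := eqVneq (theta H) 0; first by exists 0; rewrite mulr0.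
      have [k Hk] := order_exists H0; have le : (k0 <= k)%N by apply: minA; exists d, H.
      by case: Hk => u -> _; exists ('X^(k - k0) * u); rewrite mulrA -exprD subnKC.
    exists (H * 'X_0 ^+ e), (G0 * 'X_0 ^+ d), k0, (u0 * (p 0 ^+ d)%:P), (m * (p 0 ^+ e)%:P).
    split.
    + by rewrite /g !(rmorphM tf) !rmorphXn /= invf_div -/(xcoord F 0) mulf_div [X in _ / X]mulrC.
    + by rewrite mulf_neq0.
    + by rewrite thetaM thetaX G0E mulrA.
    + by rewrite hornerM hornerC mulf_neq0.
    + by rewrite thetaM thetaX HE mulrA.
  - exists (N1 * D2 + N2 * D1), (D1 * D2), (k1 + k2)%N, (u1 * u2), (m1 * u2 + m2 * u1); split.
    + by rewrite (tf_add _ _ (tf_neq0 D10) (tf_neq0 D20)).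
    + exact: mulf_neq0.
    + by rewrite thetaM E1 E2 exprD mulrACA.
    + by rewrite hornerM mulf_neq0.
    + rewrite thetaD !thetaM E1 E2 M1 M2 exprD mulrDr; congr (_ + _); first exact: mulrACA.
      by rewrite mulrACA [_ ^+ k2 * _]mulrC.
  - exists (N1 * N2), (D1 * D2), (k1 + k2)%N, (u1 * u2), (m1 * m2); split.
    + by rewrite tf_mul.
    + exact: mulf_neq0.
    + by rewrite thetaM E1 E2 exprD mulrACA.
    + by rewrite hornerM mulf_neq0.
    + by rewrite thetaM M1 M2 exprD mulrACA.
have [N [D [k [u [m [E D0 DE U NE]]]]]] := val _ (gs (BlowupChart Ig g0)).
have cross : G * 'X_0 ^+ e * D = N * ('X_0 ^+ 5 * G0).
  apply: tf_cross => //; first exact: mulf_neq0.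
  rewrite -E /L5 /O_Z /= expr1 /g !(rmorphM tf) !rmorphXn /= -/(xcoord F 0).
  exact: fraction_regroup_inv.
have := congr1 theta cross; rewrite !thetaM !thetaX DE NE G0E.
rewrite [LHS]mulrCA -[RHS]mulrA => /(mulfI (monic_neq0 (monicXn _ k))).
move/(congr1 (horner^~ 0)); rewrite !hornerM !hornerC theta0 hornerXn expr0n.
rewrite (gtn_eqF k0_gt0) /= mul0r !mulr0 => /eqP.
by rewrite !mulf_eq0 (negPf U) (negPf (p0 _)) !orbF => /eqP.
Qed.

End Vanishing.

(** * Parameters of the code *)

Section Code.
Variables (F : finFieldType) (L : fieldExtType F) (p : 'I_3 -> L).
Hypothesis hdeg : closed_point_degree p = 3%N.
Hypothesis hline : ~ on_rational_line p.
Notation q := #|F|.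
Hypothesis q5 : (5 <= q)%N.
Notation pts := (pts F).
Notation form d G := (is_true (G \is d.-homog)).
Notation tf := (@tofrac {mpoly F[3]}).
Variables (n : nat) (P : 'I_n -> rational_point (Z p)) (u : 'I_n -> F).
Hypothesis enumP : enumerates_points P.
Hypothesis u0 : forall i, u i != 0.

Let v (i : 'I_n) := plane_pt (P i).
Let c (i : 'I_n) : F :=
  u i * (first_coord (pt_vec (P i)) ^+ 5 / pt_eval (P i) (bc_gen (pt_chart (P i) : blowup_chart p))).

Let c_neq0 i : c i != 0.
Proof.
apply: mulf_neq0; first exact: u0.
apply: mulf_neq0; first by rewrite expf_neq0 // first_coord_eq0 pt_vec_neq0.
by rewrite invr_eq0 (pt_eval_gen_neq0 hdeg hline).
Qed.

Lemma fibre_coord_form G i : form 5 G -> vanishes_at p G ->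
  fibre_coord (@L5 F L p) (P i) (u i) (tf G) = c i * ev G (v i).
Proof.
move=> hG vG; rewrite /fibre_coord /L5 /O_Z expr1 invfM mulrA.
rewrite (pt_eval_frac hdeg hline _ hG vG) /c -mulrA; congr (_ * _).
rewrite /v /plane_pt /normalize (evZ _ _ hG) exprVn mulrAC; congr (_ / _).
by rewrite mulrA divff ?mul1r // expf_neq0 // first_coord_eq0 pt_vec_neq0.
Qed.

Let sections := lker (linfun (@value_at F L p 5)).
Let evaluation := linfun (weighted_values c v : dhomog 3 F 5 -> 'rV[F]_n).

Let sectionsP (G : dhomog 3 F 5) : G \in sections <-> vanishes_at p (val G).
Proof. by rewrite mem_ker_value_at; split=> [/eqP|/eqP]. Qed.

Lemma code_image w : w \in (evaluation @: sections)%VS <-> C_L (@L5 F L p) P u w.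
Proof.
split=> [/memv_imgP[G GV ->]|[s gs ->]].
  move/sectionsP: GV => vG; have hG : form 5 (val G) by case: (G).
  exists (tf (val G)); first exact: quintic_section.
  by apply/rowP => i; rewrite lfunE !mxE fibre_coord_form.
have [G hG sE] := section_poly hdeg hline gs.
have vG : vanishes_at p G by apply: (section_vanishes hline hG); rewrite -sE.
have -> : \row_i fibre_coord (@L5 F L p) (P i) (u i) s = evaluation (DHomog hG).
  by apply/rowP => i; rewrite lfunE !mxE sE fibre_coord_form.
by apply: memv_img; apply/sectionsP.
Qed.

(** Each coordinate of the code word of G is a nonzero multiple of the value of
    G at one point of the plane, and each point occurs once. *)
Let weight (G : dhomog 3 F 5) :
  (#|[set i | evaluation G 0%R i != 0%R]| + #|zeros (val G)| = q ^ 2 + q + 1)%N.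
Proof.
rewrite -(card_plane_pt hdeg hline enumP (zeros_sub (val G))).
rewrite -(enum_length hdeg hline enumP) -[RHS]card_ord.
rewrite -(cardsC [set i | evaluation G 0 i != 0]); congr (_ + _)%N.
apply: eq_card => i; rewrite !inE lfunE mxE mulf_eq0 (negPf (c_neq0 i)) /= negbK.
by have := plane_pt_pts (P i); rewrite inE => ->.
Qed.

Let section_zeros_le (G : dhomog 3 F 5) : G \in sections -> G != 0 -> (#|zeros (val G)| <= 4 * q + 2)%N.
Proof.
move=> /sectionsP vG G0; apply: (quintic_bound hline q5 _ _ vG); first by case: (G).
by apply: contraNneq G0 => E; apply/eqP/val_inj.
Qed.

(** Evaluation is injective because 4q + 2 < q^2 + q + 1 for q >= 5. *)
Lemma code_dimension : has_dimension (C_L (@L5 F L p) P u) 18.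
Proof.
exists (evaluation @: sections)%VS; split; first exact: code_image.
have := dim_forms_vanishing hdeg hline (isT : 0 < 5)%N; rewrite -/sections.
rewrite (_ : 'C(5 + 2, 5) = 21%N) // limg_dim_eq; first by lia.
apply/eqP; rewrite -subv0; apply/subvP => G; rewrite memv_cap => /andP[GV].
rewrite memv_ker memv0 => /eqP E; apply: contraT => G0.
have := weight G; have := section_zeros_le GV G0.
have -> : [set i | evaluation G 0 i != 0] = set0.
  by apply/setP => i; rewrite !inE E mxE eqxx.
by rewrite cards0 -mulnn; move: q5; clear; move: #|_| q => b a; nia.
Qed.

Lemma code_distance : has_min_distance (C_L (@L5 F L p) P u) (q ^ 2 - 3 * q - 1).
Proof.
have dist x y : hamming_dist (x : 'rV[F]_n) y = #|[set i | (x - y) 0 i != 0]|.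
  by apply: eq_card => i; rewrite !inE !mxE subr_eq0.
split.
  have [G [hG G0 vG zG]] := extremal_quintic hdeg hline q5.
  have GV : DHomog hG \in sections by apply/sectionsP.
  have d : hamming_dist (evaluation (DHomog hG)) 0 = (q ^ 2 - 3 * q - 1)%N.
    rewrite dist subr0; have := weight (DHomog hG); rewrite zG.
    by rewrite -mulnn; move: q5; clear; move: #|_| q => b a; nia.
  exists (evaluation (DHomog hG)), 0; split=> //.
  - by apply/code_image; apply: memv_img.
  - by apply/code_image; apply: mem0v.
  - apply/eqP => E; move: d; rewrite E dist subrr.
    have -> : [set i | (0 : 'rV[F]_n) 0 i != 0] = set0.
      by apply/setP => i; rewrite !inE mxE eqxx.
    by rewrite cards0 -mulnn; move: q5; clear; move: q => a; nia.
move=> x y /code_image xC /code_image yC xy.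
have : x - y \in (evaluation @: sections)%VS by apply: rpredB.
case/memv_imgP => G GV E; rewrite dist E.
have G0 : G != 0 by apply: contraNneq xy => G0; rewrite -subr_eq0 E G0 linear0.
have := weight G; have := section_zeros_le GV G0.
by rewrite -mulnn; clear; move: #|[set _ | _]| #|zeros _| q => d b a; nia.
Qed.

End Code.

Local Close Scope ring_scope.

Theorem theorem3p12 (F : finFieldType) (q : nat) (hF : #|F| = q) (hq : (5 <= q)%N)
    (L : fieldExtType F) (p : 'I_3 -> L)
    (hdeg : closed_point_degree p = 3%N)
    (hline : ~ on_rational_line p) :
  (exists (n : nat) (P : 'I_n -> rational_point (Z p)), enumerates_points P) /\
  (forall (n : nat) (P : 'I_n -> rational_point (Z p)) (u : 'I_n -> F),
     enumerates_points P -> (forall i, u i != 0%R) ->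
     has_parameters (C_L (@L5 F L p) P u)
       (q ^ 2 + q + 1) 18 (q ^ 2 - 3 * q - 1)).
Proof.
subst q; split; first exact: points_exist.
move=> n P u enumP u0; split.
- exact: enum_length hdeg hline _ _ enumP.
- exact: code_dimension.
- exact: code_distance.
Qed.
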